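(* Let $F$ be the free pro-$3$ group on two generators $x,y$, let $\sigma:F\to F$ be the automorphism with $\sigma(x)=x^{-1}$, $\sigma(y)=y^{-1}$, let $t=yxyx^{-1}y$ and, for $n\ge 1$, $r_n=x^3y^{-3^n}$. Let $G_n$ be the pro-$3$ group given by the pro-$3$ presentation \[G_n=\langle x,y\mid r_n^{-1}\sigma(r_n),\ t^{-1}\sigma(t)\rangle.\] Then for every $n\ge 1$: (i) $G_n$ is a finite $3$-group of order $3^{3n+2}$; (ii) $G_n$ is nilpotent of class $2n+1$; (iii) $G_n$ has derived length $\lfloor \log_2(3n+3)\rfloor$.
   Context: A pro-$3$ presentation $\langle x,y\mid R\rangle$ denotes the quotient of the free pro-$3$ group on $x,y$ by the closed normal subgroup generated by $R$. *)

(* Defs.v *)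
From HB Require Import structures.
From mathcomp Require Export all_boot all_order all_fingroup all_solvable.
From mathcomp Require Export boolp classical_sets functions cardinality.
From mathcomp Require Export topology.

Set Implicit Arguments.
Unset Strict Implicit.
Unset Printing Implicit Defensive.

Local Open Scope classical_set_scope.
Local Open Scope card_scope.
Local Open Scope quotient_scope.
Local Open Scope group_scope.

(* Qualified: fingroup.v shadows monoid.Group. *)
HB.mixin Record isTopGroup G of monoid.Group G & Topological G := {
  mulg_continuous : continuous (fun z : G * G => z.1 * z.2);
  invg_continuous : continuous (fun z : G => z^-1)
}.

#[short(type="topGroupType")]
HB.structure Definition TopGroup :=
  {G of isTopGroup G & monoid.Group G & Topological G}.

Section Subgroups.
Variable G : groupType.

Definition is_subgroup (A : set G) : Prop :=
  [/\ A 1, forall u v, A u -> A v -> A (u * v) & forall u, A u -> A u^-1].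

Definition is_normal_subgroup (A : set G) : Prop :=
  is_subgroup A /\ forall u g, A u -> A (u ^ g).

Definition left_cosets (A : set G) : set (set G) :=
  range (fun g : G => [set g * u | u in A]).

Record normal_subgroup := NormalSubgroup {
  normal_set : set G;
  normal_setP : is_normal_subgroup normal_set
}.

End Subgroups.

(* The quotient group G / N, as the type of classes for u^-1 * v \in N. *)
Section QuotientGroup.
Variables (G : groupType) (N : normal_subgroup G).

Definition coset_rel : rel G := fun u v => `[< normal_set N (u^-1 * v) >].

Lemma coset_rel_equiv : equiv_class_of coset_rel.
Proof.
have [[N1 NM NV] _] := normal_setP N.
split=> [u|u v|v u w].
- by apply/asboolP; rewrite mulVg.
- by apply/asboolP/asboolP => /NV; rewrite invgM invgK.
- move=> /asboolP uv /asboolP vw; apply/asboolP.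
  by have := NM _ _ uv vw; rewrite mulgA mulgK.
Qed.

Canonical coset_equiv := EquivRelPack coset_rel_equiv.

Definition quotient_group := {eq_quot coset_equiv}.

HB.instance Definition _ := Choice.on quotient_group.
HB.instance Definition _ := EqQuotient.on quotient_group.

(* fingroup.v and prime.v shadow repr and \pi. *)
Local Notation rep := (@generic_quotient.repr _ quotient_group).
Local Notation cls := (\pi_quotient_group).

Definition quot_mul (a b : quotient_group) : quotient_group :=
  cls (rep a * rep b).
Definition quot_one : quotient_group := cls 1.
Definition quot_inv (a : quotient_group) : quotient_group := cls (rep a)^-1.

Lemma quot_eqP (u v : G) :
  (cls u = cls v) <-> normal_set N (u^-1 * v).
Proof. by split=> [/eqmodP/asboolP|h]; [|apply/eqmodP/asboolP]. Qed.

Lemma quot_repr (u : G) : normal_set N (u^-1 * rep (cls u)).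
Proof. by apply/quot_eqP; rewrite reprK. Qed.

Lemma pi_mulg (u v : G) :
  cls (u * v) = quot_mul (cls u) (cls v).
Proof.
have [[N1 NM NV] NJ] := normal_setP N.
apply/quot_eqP; rewrite invgM.
have h := NJ _ (rep (cls v)) (quot_repr u).
have := NM _ _ (quot_repr v) h.
by rewrite /conjg !mulgA mulgK.
Qed.

Lemma pi_invg (u : G) : cls u^-1 = quot_inv (cls u).
Proof.
have [[N1 NM NV] NJ] := normal_setP N.
apply/quot_eqP; rewrite invgK.
have := NV _ (NJ _ (u^-1) (quot_repr u)).
by rewrite /conjg !mulgA invgK mulgV mul1g invgM invgK.
Qed.

Lemma quot_surj (a : quotient_group) : exists u, a = cls u.
Proof. by exists (rep a); rewrite reprK. Qed.

Lemma quot_mulA : associative quot_mul.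
Proof.
move=> a b c; have [u ->] := quot_surj a; have [v ->] := quot_surj b.
have [w ->] := quot_surj c.
by rewrite -(pi_mulg v w) -(pi_mulg u v) -(pi_mulg u) -(pi_mulg _ w) mulgA.
Qed.

Lemma quot_mul1 : left_id quot_one quot_mul.
Proof. by move=> a; have [u ->] := quot_surj a; rewrite -(pi_mulg 1) mul1g. Qed.

Lemma quot_mulg1 : right_id quot_one quot_mul.
Proof. by move=> a; have [u ->] := quot_surj a; rewrite -(pi_mulg u) mulg1. Qed.

Lemma quot_mulV : left_inverse quot_one quot_inv quot_mul.
Proof.
by move=> a; have [u ->] := quot_surj a; rewrite -pi_invg -(pi_mulg _ u) mulVg.
Qed.

Lemma quot_mulgV : right_inverse quot_one quot_inv quot_mul.
Proof.
by move=> a; have [u ->] := quot_surj a; rewrite -pi_invg -(pi_mulg u) mulgV.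
Qed.

HB.instance Definition _ := isGroup.Build quotient_group
  quot_mulA quot_mul1 quot_mulg1 quot_mulV quot_mulgV.

End QuotientGroup.

Section ProPGroups.
Variables (p : nat) (G : topGroupType).

Definition profinite : Prop :=
  [/\ compact [set: G], hausdorff_space G &
      forall B : set G, nbhs (1 : G) B ->
        exists U : set G, [/\ open U, is_subgroup U & U `<=` B]].

Definition pro_p : Prop :=
  profinite /\
  forall U : set G, open U -> is_normal_subgroup U ->
    exists k, left_cosets U #= `I_(p ^ k)%N.

Definition closed_normal_gen (R : set G) : set G :=
  \bigcap_(A in [set A : set G |
      [/\ closed A, is_normal_subgroup A & R `<=` A]]) A.

Lemma closed_normal_genP (R : set G) : is_normal_subgroup (closed_normal_gen R).
Proof.
split; first split.
- by move=> A [_ [[A1 _ _] _] _].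
- move=> u v hu hv A hA; have [_ [[_ AM _] _] _] := hA.
  by apply: AM; [exact: hu|exact: hv].
- by move=> u hu A hA; have [_ [[_ _ AV] _] _] := hA; exact: AV (hu A hA).
- by move=> u g hu A hA; have [_ [_ AJ] _] := hA; exact: AJ (hu A hA).
Qed.

(* For G free pro-p, the group presented by the relators R. *)
Definition presented_group (R : set G) : groupType :=
  quotient_group (NormalSubgroup (closed_normal_genP R)).

End ProPGroups.

Definition topgroup_hom (G H : topGroupType) (f : G -> H) : Prop :=
  {morph f : u v / u * v} /\ continuous f.

Definition free_pro_p2 (p : nat) (F : topGroupType) (x y : F) : Prop :=
  pro_p p F /\
  forall H : topGroupType, pro_p p H -> forall a b : H,
    exists! f : F -> H, [/\ topgroup_hom f, f x = a & f y = b].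

(* The inverse of a continuous automorphism of a compact Hausdorff group is
   automatically continuous. *)
Definition topgroup_aut (G : topGroupType) (f : G -> G) : Prop :=
  topgroup_hom f /\ bijective f.

Definition has_derived_length (gT : finGroupType) (A : {set gT}) (d : nat) :
    Prop :=
  A^`(d) = 1 /\ forall k, (k < d)%N -> A^`(k) <> 1.

Section Relators.
Variables (F : topGroupType) (x y : F) (sigma : F -> F).

Definition tword : F := y * x * y * x^-1 * y.

Definition rword (n : nat) : F := x ^+ 3 * y ^- (3 ^ n)%N.

Definition relators (n : nat) : set F :=
  [set (rword n)^-1 * sigma (rword n); tword^-1 * sigma tword]%classic.

End Relators.

(* Main.v *)
Require Import Defs.
From HB Require Import structures.
From mathcomp Require Import all_algebra.
From mathcomp Require Import zify ring.

(** In a 3-group the relator [r_n^-1 sigma(r_n)] says [x^3 = y^(3^n)], so this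
element is central, and with [w = [y, x]] the relator [t^-1 sigma(t)] says
[y^3 = [w, x]] modulo the fourth term [L_4] of the lower central series.
Commutator calculus modulo [L_5] then shows that [L_4] is generated by [w^3]
modulo [L_5]; as cubing maps [L_k] to [L_(k+2)] and commutes with commutators
to leading order, the factors [L_k / L_(k+1)] have order at most 9 ([k] odd) or
3 ([k] even), and the centrality of [y^(3^n)] kills [L_(2n+2)].  Hence any
3-group satisfying the relations has order at most [3^(3n+2)].

This order is attained.  The group [S] of matrices [[a, b], [3c, d]] of
determinant 1, with [a = 1] modulo 3 and entries [a, b, c, d] in [Z/3^(n+1)], is
generated by [x = [[1, 1], [-3, -2]]] and [y = theta [[1, 1], [3, 1]]] with
[2 theta^2 = -1]; they satisfy the second relation, [x^3 = 1], and [y^(3^n)] is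
central of order dividing 3.  Twisting by [Z/9], namely taking the subgroup
generated by [(x, 1)] and [(y, 0)] in [S * Z/9] modulo [(y^-(3^n), 3)], repairs
the first relation and keeps the order and the derived series.  The latter
runs through the congruence filtration of [S] at indices 1, 2, 5, 10, 21, ...

Finally, a closed normal subgroup of a free pro-3 group is an intersection of
open normal ones, so the presented group is determined by its finite
3-quotients, all of which are quotients of the model. *)

Set Implicit Arguments.
Unset Strict Implicit.
Unset Printing Implicit Defensive.

(** * Matrices over [Z/3^(n+1)] *)

Section Iwahori.
Variable R : finComUnitRingType.
Local Open Scope ring_scope.
Import GRing.Theory.
Implicit Types (r s a b c d : R) (i j k l m : nat).

Definition dv3 i r : bool := [exists s, r == 3 ^+ i * s].

Lemma dv3P i r : reflect (exists s, r = 3 ^+ i * s) (dv3 i r).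
Proof. by apply: (iffP existsP) => -[s /eqP]; exists s => //; apply/eqP. Qed.

Lemma dv3_0 r : dv3 0 r.
Proof. by apply/dv3P; exists r; rewrite expr0 mul1r. Qed.
Lemma dv3_zero i : dv3 i 0.
Proof. by apply/dv3P; exists 0; rewrite mulr0. Qed.
Lemma dv3_exp i s : dv3 i (3 ^+ i * s).
Proof. by apply/dv3P; exists s. Qed.
Lemma dv3_le i j r : dv3 i r -> (j <= i)%N -> dv3 j r.
Proof.
move=> /dv3P[s ->] le_ji; apply/dv3P; exists (3 ^+ (i - j) * s).
by rewrite mulrA -exprD subnKC.
Qed.
Lemma dv3D i r s : dv3 i r -> dv3 i s -> dv3 i (r + s).
Proof.
by move=> /dv3P[r' ->] /dv3P[s' ->]; apply/dv3P; exists (r' + s'); rewrite mulrDr.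
Qed.
Lemma dv3N i r : dv3 i r -> dv3 i (- r).
Proof. by move=> /dv3P[r' ->]; apply/dv3P; exists (- r'); rewrite mulrN. Qed.
Lemma dv3B i r s : dv3 i r -> dv3 i s -> dv3 i (r - s).
Proof. by move=> dr ds; apply/dv3D/dv3N. Qed.
Lemma dv3M i j r s : dv3 i r -> dv3 j s -> dv3 (i + j) (r * s).
Proof.
move=> /dv3P[r' ->] /dv3P[s' ->]; apply/dv3P; exists (r' * s').
by rewrite mulrACA -exprD.
Qed.
Lemma dv3Ml i r s : dv3 i s -> dv3 i (r * s).
Proof. by move=> ds; apply: (dv3M (dv3_0 r)). Qed.
Lemma dv3_3 r : dv3 1 (3 * r).
Proof. by apply/dv3P; exists r; rewrite expr1. Qed.

Lemma dv3_three : dv3 1 (3 : R).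
Proof. by rewrite -[3]mulr1 dv3_3. Qed.

Definition quad : Type := (R * R * R * R)%type.
Implicit Types (p q u v : quad).

(* (a, b, c, d) stands for the matrix [[a, b], [3 c, d]]. *)
Definition qmul p q : quad :=
  let: (a, b, c, d) := p in let: (a', b', c', d') := q in
  (a * a' + 3 * b * c', a * b' + b * d', c * a' + d * c', 3 * c * b' + d * d').
Definition qadd p q : quad :=
  let: (a, b, c, d) := p in let: (a', b', c', d') := q in
  (a + a', b + b', c + c', d + d').
Definition qopp p : quad := let: (a, b, c, d) := p in (- a, - b, - c, - d).
Definition qsub p q := qadd p (qopp q).
Definition qone : quad := (1, 0, 0, 1).
Definition qthree : quad := (3, 0, 0, 3).
Definition qadj p : quad := let: (a, b, c, d) := p in (d, - b, - c, a).
Definition qdet p : R := let: (a, b, c, d) := p in a * d - 3 * b * c.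

(** Membership in the [i]-th power of the radical of the order of matrices [[a, b], [3 c, d]]: the
    radical has both diagonal entries divisible by 3, and its square is 3 times the order. *)
Definition radp i p : bool :=
  let: (a, b, c, d) := p in
  [&& dv3 (uphalf i) a, dv3 i./2 b, dv3 i./2 c & dv3 (uphalf i) d].

Lemma radpD i p q : radp i p -> radp i q -> radp i (qadd p q).
Proof.
case: p q => [[[a b] c] d] [[[a' b'] c'] d'] /and4P[? ? ? ?] /and4P[? ? ? ?].
by apply/and4P; split; apply: dv3D.
Qed.
Lemma radpN i p : radp i p -> radp i (qopp p).
Proof.
case: p => [[[a b] c] d] /and4P[? ? ? ?].
by apply/and4P; split; apply: dv3N.
Qed.
Lemma radpB i p q : radp i p -> radp i q -> radp i (qsub p q).
Proof. by move=> ip iq; apply/radpD/radpN. Qed.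
Lemma radp_le i j p : radp i p -> (j <= i)%N -> radp j p.
Proof.
case: p => [[[a b] c] d] /and4P[pa pb pc pd] le_ji; apply/and4P.
by split; [apply: dv3_le pa _ | apply: dv3_le pb _ | apply: dv3_le pc _
  | apply: dv3_le pd _]; lia.
Qed.
Lemma radpM i j p q : radp i p -> radp j q -> radp (i + j) (qmul p q).
Proof.
case: p q => [[[a b] c] d] [[[a' b'] c'] d'].
move=> /and4P[pa pb pc pd] /and4P[qa qb qc qd].
apply/and4P; split; apply: dv3D.
- by apply: dv3_le (dv3M pa qa) _; lia.
- by apply: dv3_le (dv3M (dv3M dv3_three pb) qc) _; lia.
- by apply: dv3_le (dv3M pa qb) _; lia.
- by apply: dv3_le (dv3M pb qd) _; lia.
- by apply: dv3_le (dv3M pc qa) _; lia.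
- by apply: dv3_le (dv3M pd qc) _; lia.
- by apply: dv3_le (dv3M (dv3M dv3_three pc) qb) _; lia.
- by apply: dv3_le (dv3M pd qd) _; lia.
Qed.
Lemma radp0 p : radp 0 p.
Proof. by case: p => [[[a b] c] d]; rewrite /= !dv3_0. Qed.
Lemma radp_three : radp 2 qthree.
Proof. by rewrite /= !dv3_zero dv3_three. Qed.

(** Over Z/3^(n+1) this is the reduction of the pro-3 Iwahori subgroup of SL_2; that [d = 1] modulo
    3 follows from the determinant. Storing [c] rather than [3 c] keeps [c] at full precision. *)
Definition iw_pred p : bool := (qdet p == 1) && dv3 1 (p.1.1.1 - 1).

Record iwahori := Iwahori { iw_val : quad; _ : iw_pred iw_val }.
HB.instance Definition _ := [isSub for iw_val].
HB.instance Definition _ := [Finite of iwahori by <:].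

Lemma qmulA : associative qmul.
Proof.
move=> [[[a b] c] d] [[[a' b'] c'] d'] [[[a2 b2] c2] d2].
by congr (_, _, _, _); ring.
Qed.
Lemma qmul1 : left_id qone qmul.
Proof. by move=> [[[a b] c] d]; congr (_, _, _, _); ring. Qed.
Lemma qmulBr p q u : qmul p (qsub q u) = qsub (qmul p q) (qmul p u).
Proof.
case: p q u => [[[a b] c] d] [[[a' b'] c'] d'] [[[a2 b2] c2] d2].
by congr (_, _, _, _); ring.
Qed.
Lemma qdetM p q : qdet (qmul p q) = qdet p * qdet q.
Proof. by case: p q => [[[a b] c] d] [[[a' b'] c'] d'] /=; ring. Qed.
Lemma qmul_adj p : qdet p = 1 -> qmul (qadj p) p = qone.
Proof.
case: p => [[[a b] c] d] /= detp; congr (_, _, _, _); try ring.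
  by rewrite -[RHS]detp; ring.
by rewrite -[RHS]detp; ring.
Qed.

Lemma iw_pred_diag p : iw_pred p -> dv3 1 (p.2 - 1).
Proof.
case: p => [[[a b] c] d] /andP[/eqP/= detp da].
have -> : d - 1 = 3 * (b * c) - d * (a - 1).
  by rewrite -[X in d - X]detp; ring.
by apply: dv3B; [apply: dv3_3 | apply: dv3Ml].
Qed.

Lemma iw_predM p q : iw_pred p -> iw_pred q -> iw_pred (qmul p q).
Proof.
rewrite /iw_pred qdetM => /andP[/eqP-> pa] /andP[/eqP-> qa]; rewrite mulr1 eqxx /=.
case: p q pa qa => [[[a b] c] d] [[[a' b'] c'] d'] /= pa qa.
have -> : a * a' + 3 * b * c' - 1 = a * (a' - 1) + (a - 1) + 3 * (b * c') by ring.
by apply: dv3D; [apply: dv3D => //; apply: dv3Ml | apply: dv3_3].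
Qed.
Lemma iw_pred1 : iw_pred qone.
Proof. by rewrite /iw_pred /= subrr dv3_zero mulr1 !mulr0 subr0 eqxx. Qed.
Lemma iw_pred_adj p : iw_pred p -> iw_pred (qadj p).
Proof.
move=> pp; have := iw_pred_diag pp; move: pp.
case: p => [[[a b] c] d] /andP[/eqP/= detu _] dd; rewrite /iw_pred dd andbT /=.
by apply/eqP; rewrite -[RHS]detu; ring.
Qed.

Definition iw_mul (u v : iwahori) := Iwahori (iw_predM (valP u) (valP v)).
Definition iw_one := Iwahori iw_pred1.
Definition iw_inv (u : iwahori) := Iwahori (iw_pred_adj (valP u)).

Lemma iw_mulA : associative iw_mul.
Proof. by move=> u v w; apply: val_inj; apply: qmulA. Qed.
Lemma iw_mul1 : left_id iw_one iw_mul.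
Proof. by move=> u; apply: val_inj; apply: qmul1. Qed.
Lemma iw_mulV : left_inverse iw_one iw_inv iw_mul.
Proof.
by move=> u; apply: val_inj; apply: qmul_adj; have /andP[/eqP] := valP u.
Qed.
HB.instance Definition _ := Finite_isGroup.Build iwahori iw_mulA iw_mul1 iw_mulV.

End Iwahori.

(** * The congruence filtration of the matrix group *)

Section Filtration.
Variables (R : finComUnitRingType) (N : nat).
Local Open Scope ring_scope.
Import GRing.Theory.
Hypothesis nil3 : (3 : R) ^+ N = 0.
Hypothesis unit3 : forall r : R, 1 + 3 * r \is a GRing.unit.
Implicit Types (r s t a b c d : R) (i j k l m : nat).
Local Notation S := (iwahori R).

Lemma val_iwM (u v : S) : val (u * v)%g = qmul (val u) (val v). Proof. by []. Qed.
Lemma val_iwV (u : S) : val (u^-1)%g = qadj (val u). Proof. by []. Qed.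
Lemma val_iw1 : val (1%g : S) = qone R. Proof. by []. Qed.

Definition radg i : {set S} := [set u | radp i (qsub (val u) (qone R))].

Lemma radg_group_set i : group_set (radg i).
Proof.
apply/group_setP; split=> [|u v]; rewrite !inE.
  have -> : qsub (val (1%g : S)) (qone R) = (0, 0, 0, 0).
    by congr (_, _, _, _); rewrite ?oppr0 ?addr0 ?subrr.
  by rewrite /= !dv3_zero.
rewrite val_iwM; set p := val u; set q := val v => ip iq.
have -> : qsub (qmul p q) (qone R) =
    qadd (qmul (qsub p (qone R)) (qsub q (qone R)))
         (qadd (qsub p (qone R)) (qsub q (qone R))).
  case: p q {ip iq} => [[[a b] c] d] [[[a' b'] c'] d'].
  by congr (_, _, _, _); ring.
by apply: radpD; [apply: radp_le (radpM ip iq) _; lia | apply: radpD].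
Qed.
Canonical radg_group i := Group (radg_group_set i).

Lemma radg_le i j u : u \in radg i -> (j <= i)%N -> u \in radg j.
Proof. by rewrite !inE; apply: radp_le. Qed.

Lemma radg1 u : u \in radg 1.
Proof.
have := valP u; have := iw_pred_diag (valP u); rewrite inE.
by case: (val u) => [[[a b] c] d] /= dd /andP[_ /= da]; rewrite da dd !dv3_0.
Qed.

Lemma dv3_nil r : dv3 N r -> r = 0.
Proof. by move=> /dv3P[s ->]; rewrite nil3 mul0r. Qed.

Lemma radg_trivial i u : (2 * N <= i)%N -> u \in radg i -> u = 1%g.
Proof.
move=> le_i /radg_le/(_ le_i); rewrite inE => ru; apply: val_inj; move: ru.
rewrite val_iw1; case: (val u) => [[[a b] c] d] /and4P[pa pb pc pd].
have -> : a = 1 by apply/eqP; rewrite -subr_eq0; apply/eqP/dv3_nil/(dv3_le pa); lia.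
have -> : d = 1 by apply/eqP; rewrite -subr_eq0; apply/eqP/dv3_nil/(dv3_le pd); lia.
by congr (_, _, _, _); apply/eqP; rewrite -subr_eq0; apply/eqP/dv3_nil;
  [apply: dv3_le pb _ | apply: dv3_le pc _]; lia.
Qed.

(** Since [g^-1 u - 1 = g^-1 (u - g)], an additive congruence becomes a multiplicative one. *)
Lemma radg_approx i (u g : S) :
  radp i (qsub (val u) (val g)) -> (g^-1 * u)%g \in radg i.
Proof.
move=> ri; rewrite inE val_iwM.
have -> : qone R = qmul (val g^-1%g) (val g) by rewrite -val_iwM mulVg.
by rewrite -qmulBr; apply: (radpM (radp0 _)).
Qed.

(** [u v - v u] is the additive commutator of [u - 1] and [v - 1], and [v - 1] lies in the radical,
    so one level is gained. *)
Lemma radg_commute i (u v : S) :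
  u \in radg i -> (2 * N <= i.+1)%N -> commute u v.
Proof.
move=> Du le_i; suff : ((v * u)^-1 * (u * v))%g \in radg i.+1.
  by move=> /(radg_trivial le_i)/eqP; rewrite -eq_mulVg1 => /eqP.
apply: radg_approx; have := radg1 v; move: Du; rewrite !inE !val_iwM.
set p := val u; set q := val v => ip iq.
have -> : qsub (qmul p q) (qmul q p) =
   qsub (qmul (qsub p (qone R)) (qsub q (qone R)))
        (qmul (qsub q (qone R)) (qsub p (qone R))).
  case: p q {ip iq} => [[[a b] c] d] [[[a' b'] c'] d'].
  by congr (_, _, _, _); ring.
by apply: radpB; [rewrite -addn1 | rewrite -add1n]; apply: radpM.
Qed.

Lemma radg_cube i u : (0 < i)%N -> u \in radg i -> (u ^+ 3)%g \in radg i.+2.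
Proof.
move=> i_gt0; rewrite !inE !expgS expg0 mulg1 !val_iwM; set p := val u => ip.
set p' := qsub p (qone R) in ip *.
(* The expansion [u^3 - 1 = p'^3 + 3 p'^2 + 3 p']: the factor 3 has level 2, and [3 i >= i + 2]
   since [i > 0]. *)
have -> : qsub (qmul p (qmul p p)) (qone R) =
    qadd (qmul p' (qmul p' p')) (qadd (qmul (qthree R) (qmul p' p')) (qmul (qthree R) p')).
  rewrite /p'; case: p {p' ip} => [[[a b] c] d].
  by congr (_, _, _, _); ring.
have i2 := radpM ip ip.
apply: radpD; first by apply: radp_le (radpM ip i2) _; lia.
by apply: radpD; [apply: radp_le (radpM (radp_three R) i2) _ |
  apply: radp_le (radpM (radp_three R) ip) _]; lia.
Qed.

Lemma upper_iw s : iw_pred ((1, s, 0, 1) : quad R).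
Proof. by rewrite /iw_pred /= subrr dv3_zero mulr1 !mulr0 subr0 eqxx. Qed.
Lemma lower_iw s : iw_pred ((1, 0, s, 1) : quad R).
Proof. by rewrite /iw_pred /= subrr dv3_zero mulr1 mulr0 mul0r subr0 eqxx. Qed.
Lemma diag_iw k : iw_pred ((1 + 3 ^+ k.+1, 0, 0, (1 + 3 ^+ k.+1)^-1) : quad R).
Proof.
rewrite /iw_pred /= exprS mulrV ?unit3 // mulr0 subr0 eqxx /=.
by rewrite addrC addKr dv3_3.
Qed.

Definition upper s : S := Iwahori (upper_iw s).
Definition lower s : S := Iwahori (lower_iw s).
Definition diag k : S := Iwahori (diag_iw k).

Lemma upper_radg i s : dv3 i./2 s -> upper s \in radg i.
Proof. by move=> ds; rewrite inE /= subrr oppr0 !addr0 !dv3_zero ds. Qed.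
Lemma lower_radg i s : dv3 i./2 s -> lower s \in radg i.
Proof. by move=> ds; rewrite inE /= subrr oppr0 !addr0 !dv3_zero ds. Qed.
Lemma diag_radg i k : (uphalf i <= k.+1)%N -> diag k \in radg i.
Proof.
move=> le_i; rewrite inE /= oppr0 !addr0 !dv3_zero.
have d1 : dv3 (uphalf i) (3 ^+ k.+1 : R).
  by apply: dv3_le le_i; rewrite -[X in dv3 _ X]mulr1 dv3_exp.
rewrite [1 + _]addrC addrK d1 /=.
set a := 3 ^+ k.+1 + 1; have ua : a \is a GRing.unit by rewrite /a addrC exprS unit3.
have -> : a^-1 - 1 = - a^-1 * 3 ^+ k.+1.
  apply: (mulrI ua); rewrite mulNr mulrN mulrBr mulrA mulrV // mul1r mulr1 /a.
  by rewrite opprD addrCA subrr addr0.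
by apply: dv3Ml.
Qed.

(** The leading term is diagonal, so such commutators fill the even layers of the filtration; the
    commutators with [diag k] are off-diagonal and fill the odd layers. *)
Lemma comm_upper_lower s t : val [~ upper s, lower t]%g =
  (1 + 3 * s * t + 9 * s ^+ 2 * t ^+ 2, 3 * s ^+ 2 * t, - (3 * s * t ^+ 2),
   1 - 3 * s * t).
Proof. by congr (_, _, _, _); ring. Qed.

Lemma comm_diag_upper k s (a := 1 + 3 ^+ k.+1 : R) :
  [~ diag k, upper s]%g = upper (s * (1 - a ^- 2)).
Proof.
have ua : a \is a GRing.unit by rewrite /a exprS unit3.
apply: val_inj; rewrite /commg /conjg !val_iwM !val_iwV.
have -> : val (diag k) = (a, 0, 0, a^-1) by [].
congr (_, _, _, _).
- by rewrite -[RHS](mulVr ua); ring.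
- by rewrite -exprVn -[X in s * (X - _)](mulVr ua); ring.
- by ring.
- by rewrite -[RHS](mulVr ua); ring.
Qed.

Lemma comm_diag_lower k s (a := 1 + 3 ^+ k.+1 : R) :
  [~ diag k, lower s]%g = lower (s * (1 - a ^+ 2)).
Proof.
have ua : a \is a GRing.unit by rewrite /a exprS unit3.
apply: val_inj; rewrite /commg /conjg !val_iwM !val_iwV.
have -> : val (diag k) = (a, 0, 0, a^-1) by [].
congr (_, _, _, _).
- by rewrite -[RHS](mulVr ua); ring.
- by ring.
- by rewrite -[X in s * (X - _)](mulVr ua); ring.
- by rewrite -[RHS](mulVr ua); ring.
Qed.

(** Successive approximation: each factor [g] pushes [g^-1 u] one level deeper, and level [2 N] is
    trivial. *)
Lemma radg_lift M (A : {group S}) :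
    (forall i u, (M <= i)%N -> u \in radg i ->
       exists2 g, g \in A & radp i.+1 (qsub (val u) (val g))) ->
  radg M \subset A.
Proof.
move=> approx.
suff lift k i u : (M <= i)%N -> (2 * N <= i + k)%N -> u \in radg i -> u \in A.
  by apply/fintype.subsetP=> u; apply: (lift (2 * N)%N) => //; lia.
elim: k i u => [|k IHk] i u le_Mi le_N Du.
  by rewrite (radg_trivial _ Du) ?group1 //; lia.
have [g Ag /radg_approx Dgu] := approx i u le_Mi Du.
rewrite -[u](mulKVg g) groupM //; apply: IHk Dgu; lia.
Qed.

(** Layers [2 l] are diagonal, with one free entry because of the determinant, and are reached by
    commutators of [upper] and [lower]. Layers [2 l + 1] are off-diagonal and reached by commutators
    of [diag] with [upper] and [lower]. The two hypotheses on [M] say when these matrices can be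
    taken in [radg m]. *)
Lemma comm_radg m M : (0 < m)%N -> (forall l, M <= l.*2 -> m./2.*2 < l)%N ->
    (forall l, M <= l.*2.+1 -> m <= l)%N ->
  radg M \subset [~: radg m, radg m]%g.
Proof.
move=> m_gt0 M_even M_odd; apply: radg_lift => i u le_Mi.
have [l [Di|Di]] : exists l, i = l.*2 \/ i = l.*2.+1.
  exists i./2; rewrite -{1 3}(odd_double_half i).
  by case: (odd i); [right | left].
- rewrite {i}Di in le_Mi * => Du; have lt_l := M_even l le_Mi.
  move: Du; rewrite inE; have /andP[/eqP] := valP u.
  case Eu: (val u) => [[[a b] c] d] /= detu _.
  rewrite uphalf_double doubleK oppr0 !addr0 => /and4P[/dv3P[p Dp] pb pc pd].
  (* [s] has the least valuation allowed in [radg m], and [t] is then fixed by [3 s t = a - 1]; it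
     lies in [radg m] because [2 * m./2 < l]. *)
  pose s : R := 3 ^+ m./2; pose t := 3 ^+ (l.-1 - m./2) * p.
  exists [~ upper s, lower t]%g.
    apply: mem_commg.
      by apply: upper_radg; rewrite -[X in dv3 _ X]mulr1 dv3_exp.
    by apply: lower_radg; apply: dv3_le (dv3_exp _ _) _; lia.
  have stE : 3 * s * t = 3 ^+ l * p.
    by rewrite /s /t -exprS mulrA -exprD (_ : _ + _ = l)%N //; lia.
  rewrite comm_upper_lower /= uphalf_double doubleK; apply/and4P; split.
  - have -> : a - (1 + 3 * s * t + 9 * s ^+ 2 * t ^+ 2) =
        (a - 1) - 3 * s * t - (3 * s * t) * (3 * s * t) by ring.
    rewrite stE -Dp subrr sub0r; apply: dv3N.
    by rewrite Dp; apply: dv3_le (dv3M (dv3_exp _ _) (dv3_exp _ _)) _; lia.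
  - have -> : b - 3 * s ^+ 2 * t = b - s * (3 * s * t) by ring.
    by rewrite stE; apply: dv3B => //; apply/dv3Ml/dv3_exp.
  - have -> : c - - (3 * s * t ^+ 2) = c + t * (3 * s * t) by ring.
    by rewrite stE; apply: dv3D => //; apply/dv3Ml/dv3_exp.
  (* The last entry is not free: the determinant expresses its error through the other entries. *)
  have -> : d - (1 - 3 * s * t) = 3 * b * c - (a - 1) * (d - 1).
    rewrite stE -Dp; have -> : d - (1 - (a - 1)) = d + a - 1 - 1 by ring.
    by rewrite -{2}detu; ring.
  apply: dv3B; last by rewrite Dp; apply: dv3_le (dv3M (dv3_exp _ _) pd) _; lia.
  by apply: dv3_le (dv3M (dv3M (dv3_three _) pb) pc) _; lia.
rewrite {i}Di in le_Mi * => Du; have le_ml := M_odd l le_Mi.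
move: Du; rewrite inE; case Eu: (val u) => [[[a b] c] d] /=.
rewrite /= uphalf_double doubleK oppr0 !addr0 => /and4P[pa pb pc pd].
(* [k] is the least index with [diag k] in [radg m]. Its commutators multiply off-diagonal entries
   by [1 - e^-2] and [1 - e^2], each [3^(k+1)] times a unit; dividing [b] and [c] by these gives [s]
   and [t]. *)
pose k := (uphalf m).-1; have k1 : k.+1 = uphalf m by rewrite prednK //; lia.
pose e : R := 1 + 3 ^+ k.+1; pose f : R := 2 + 3 ^+ k.+1.
have ue : e \is a GRing.unit by rewrite /e exprS unit3.
have uf : f \is a GRing.unit.
  have -> : f = - (1 + 3 * (-1 - 3 ^+ k)) by rewrite /f exprS; ring.
  by rewrite unitrN unit3.
have fE : e ^+ 2 - 1 = 3 ^+ k.+1 * f by rewrite /e /f; ring.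
have [b' Db] := dv3P _ _ pb; have [c' Dc] := dv3P _ _ pc.
pose s := 3 ^+ (l - k.+1) * (b' * e ^+ 2 * f^-1).
pose t := 3 ^+ (l - k.+1) * (- (c' * f^-1)).
have lk : (k.+1 + (l - k.+1) = l)%N by lia.
have bE : s * (1 - e ^- 2) = b.
  have -> : 1 - e ^- 2 = e ^- 2 * (e ^+ 2 - 1).
    by rewrite mulrBr mulVr ?unitrX // mulr1.
  rewrite fE Db -[in RHS]lk exprD /s.
  transitivity (3 ^+ k.+1 * 3 ^+ (l - k.+1) * b' * (e ^+ 2 * e ^- 2) * (f^-1 * f)).
    by ring.
  by rewrite mulrV ?unitrX // mulVr // !mulr1.
have cE : t * (1 - e ^+ 2) = c.
  have -> : 1 - e ^+ 2 = - (e ^+ 2 - 1) by ring.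
  rewrite fE Dc -[in RHS]lk exprD /t.
  transitivity (3 ^+ k.+1 * 3 ^+ (l - k.+1) * c' * (f^-1 * f)); first by ring.
  by rewrite mulVr // !mulr1.
exists ([~ diag k, upper s] * [~ diag k, lower t])%g.
  have dk : diag k \in radg m by apply: diag_radg; rewrite k1.
  apply: groupM; apply: mem_commg => //.
    by apply: upper_radg; apply: dv3_le (dv3_exp _ _) _; lia.
  by apply: lower_radg; apply: dv3_le (dv3_exp _ _) _; lia.
rewrite comm_diag_upper comm_diag_lower val_iwM bE cE /= uphalf_double doubleK.
apply/and4P; split.
- have -> : a - (1 * 1 + 3 * b * c) = (a - 1) - 3 * b * c by ring.
  apply: dv3B => //.
  by apply: dv3_le (dv3M (dv3M (dv3_three _) pb) pc) _; lia.
- by rewrite (_ : _ - _ = 0) ?dv3_zero //; ring.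
- by rewrite (_ : _ - _ = 0) ?dv3_zero //; ring.
- by rewrite !mulr0 add0r mulr1.
Qed.

Lemma radg_neq1 i : (i < 2 * N)%N -> (3 : R) ^+ N.-1 != 0 -> radg i != 1%g.
Proof.
move=> lt_i nz; apply/eqP=> triv.
have : upper (3 ^+ N.-1) \in radg i.
  apply: upper_radg; apply: (@dv3_le _ N.-1); last by lia.
  by rewrite -[X in dv3 _ X]mulr1 dv3_exp.
rewrite triv => /set1gP/(congr1 val)[] /eqP; exact/negP.
Qed.

End Filtration.

(* The term of the lower central series that equals the [d]-th derived group. *)
Fixpoint der_weight d : nat :=
  if d is d'.+1 then
    let m := der_weight d' in if odd m then m.*2 else m.*2.+1
  else 1.

(** Closed form: the weight is the integer part of [2^(d+2) / 3]. It turns comparisons of weights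
    with [2 n + 2] into comparisons of powers of 2 with [3 n + 3]. *)
Lemma der_weightE d :
  odd (der_weight d) = ~~ odd d /\ (3 * der_weight d + (odd d).+1 = 2 ^ d.+2)%N.
Proof.
elim: d => [//|d [IHo IHd]] /=; rewrite IHo negbK [(2 ^ d.+3)%N]expnS -IHd.
by case: (odd d) {IHd} => /=; rewrite ?odd_double; split=> //; lia.
Qed.

Lemma der_weight_gt0 d : (0 < der_weight d)%N.
Proof.
have [_] := der_weightE d; have := expn_gt0 2 d.
by rewrite !expnS; case: (odd d); lia.
Qed.

(** * Two generators and the derived series of the matrix group *)

Section Generators.
Variables (R : finComUnitRingType) (n : nat) (theta : R).
Local Open Scope ring_scope.
Import GRing.Theory.
Hypothesis nil3 : (3 : R) ^+ n.+1 = 0.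
Hypothesis unit3 : forall r : R, 1 + 3 * r \is a GRing.unit.
Hypothesis residue3 : forall r : R, exists i : nat, dv3 1 (r - i%:R).
Hypothesis theta_sqr : 2 * theta ^+ 2 = -1.
Hypothesis theta_1 : dv3 1 (theta - 1).
Local Notation S := (iwahori R).

Lemma iw_x_pred : iw_pred ((1, 1, -1, -2) : quad R).
Proof. by rewrite /iw_pred /= subrr dv3_zero andbT; apply/eqP; ring. Qed.
Lemma iw_y_pred : iw_pred ((theta, theta, theta, theta) : quad R).
Proof.
rewrite /iw_pred /= theta_1 andbT; apply/eqP.
have -> : theta * theta - 3 * theta * theta = - (2 * theta ^+ 2) by ring.
by rewrite theta_sqr opprK.
Qed.
Definition iw_x : S := Iwahori iw_x_pred.
Definition iw_y : S := Iwahori iw_y_pred.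

Lemma iw_x_cube : (iw_x ^+ 3 = 1)%g.
Proof.
apply: val_inj; rewrite !expgS expg0 mulg1 !val_iwM val_iw1.
by congr (_, _, _, _); ring.
Qed.

Lemma iw_rel_t :
  (iw_y * iw_x * iw_y * iw_x^-1 * iw_y =
   iw_y^-1 * iw_x^-1 * iw_y^-1 * iw_x * iw_y^-1)%g.
Proof.
apply: val_inj; rewrite !val_iwM !val_iwV.
by congr (_, _, _, _); ring.
Qed.

Lemma iw_y_pow j : (iw_y ^+ (3 ^ j))%g \in radg R (2 * j + 1).
Proof.
elim: j => [|j IHj]; first exact: radg1.
rewrite expnSr expgM; apply: radg_le (radg_cube _ IHj) _; lia.
Qed.

(** Level [2 n + 1] is the last nontrivial one, and a commutator with any element gains one
    level. *)
Lemma iw_y_central u : commute (iw_y ^+ (3 ^ n))%g u.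
Proof. by apply: (radg_commute nil3 _ (iw_y_pow n)); lia. Qed.

Lemma iw_y_order : (iw_y ^+ (3 ^ n) ^+ 3 = 1)%g.
Proof.
have c := radg_cube _ (iw_y_pow n).
by apply: (radg_trivial nil3 _ (c _)); lia.
Qed.

Lemma radg_der k : radg R (der_weight k) \subset ([set: S]^`(k))%g.
Proof using nil3 unit3.
clear theta theta_sqr theta_1; elim: k => [|k IHk]; first exact: finset.subsetT.
rewrite dergSn; apply: fintype.subset_trans (commgSS IHk IHk).
have m_gt0 := der_weight_gt0 k; move: m_gt0 => /=; set m := der_weight k => m_gt0.
(* For even [m] the strict bound in [comm_radg] excludes layer [2 m], whence the weight [2 m + 1];
   for odd [m] layer [2 m] is included. *)
by apply: (comm_radg nil3 unit3) => // l; have := odd_double_half m; case: (odd m); lia.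
Qed.

Lemma iw_der_neq1 k : (3 : R) ^+ n != 0 -> (der_weight k < 2 * n.+1)%N ->
  ([set: S]^`(k) != 1)%g.
Proof using nil3 unit3.
move=> nz lt_k; apply: contra_neq (radg_neq1 lt_k nz) => triv.
by apply/trivgP; rewrite /= -triv radg_der.
Qed.

(** Off-diagonal entries modulo 3 add up under multiplication: a homomorphism to two copies of Z/3,
    with kernel [radg 2]. *)
Let offdiag (u : S) (b c : R) := dv3 1 ((val u).1.1.2 - b) /\ dv3 1 ((val u).1.2 - c).

Let offdiagM u v b c b' c' : offdiag u b c -> offdiag v b' c' ->
  offdiag (u * v)%g (b + b') (c + c').
Proof.
rewrite /offdiag val_iwM.
have := valP u; have := valP v; have := iw_pred_diag (valP u).
have := iw_pred_diag (valP v).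
case: (val u) (val v) => [[[a1 b1] c1] d1] [[[a2 b2] c2] d2] /= d2' d1'.
move=> /andP[_ /= a2'] /andP[_ /= a1'] [db1 dc1] [db2 dc2]; split.
  have -> : a1 * b2 + b1 * d2 - (b + b') =
    b2 * (a1 - 1) + b1 * (d2 - 1) + (b1 - b) + (b2 - b') by ring.
  by do 3?apply: dv3D => //; apply: dv3Ml.
have -> : c1 * a2 + d1 * c2 - (c + c') =
  c1 * (a2 - 1) + c2 * (d1 - 1) + (c1 - c) + (c2 - c') by ring.
by do 3?apply: dv3D => //; apply: dv3Ml.
Qed.

Let offdiag1 : offdiag 1%g 0 0.
Proof. by rewrite /offdiag /= subrr dv3_zero. Qed.

Let offdiagX u b c i : offdiag u b c -> offdiag (u ^+ i)%g (b *+ i) (c *+ i).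
Proof.
move=> du; elim: i => [|i IHi]; first by rewrite expg0 !mulr0n; apply: offdiag1.
by rewrite expgS !mulrS; apply: offdiagM.
Qed.

Let offdiag_radg u : offdiag u 0 0 -> u \in radg R 2.
Proof.
case; rewrite !subr0 inE; have := valP u; have := iw_pred_diag (valP u).
case: (val u) => [[[a b] c] d] /= dd /andP[_ /= da] db dc.
by rewrite da dd oppr0 !addr0 db dc.
Qed.

(** Burnside's basis theorem: the off-diagonal residues of the generators, (1, -1) and (1, 1), are
    independent modulo 3. *)
Lemma iw_gen : (3.-group [set: S])%g -> <<[set iw_x; iw_y]>>%g = [set: S].
Proof.
move=> pS; apply: Phi_nongen; apply/eqP; rewrite finset.eqEsubset finset.subsetT /=.
apply/fintype.subsetP=> u _.
have [i Hi] := residue3 (val u).1.1.2; have [j Hj] := residue3 (val u).1.2.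
(* The exponents [alpha], [beta] solve [alpha + beta = i] and [beta - alpha = j] modulo 3, where 2
   is its own inverse. *)
pose g := (iw_x ^+ (j + 2 * i) * iw_y ^+ (2 * (i + j)))%g.
have dx : offdiag iw_x 1 (-1) by rewrite /offdiag /= !subrr dv3_zero.
have dy : offdiag iw_y 1 1 by rewrite /offdiag /= theta_1.
have dg : offdiag g _ _ :=
  offdiagM (offdiagX (j + 2 * i) dx) (offdiagX (2 * (i + j)) dy).
have Pg : g \in ('Phi([set: S]) <*> [set iw_x; iw_y])%g.
  by rewrite groupM ?groupX // mem_gen // !inE eqxx !orbT.
clearbody g.
have Dgu : (g^-1 * u)%g \in radg R 2.
  apply: offdiag_radg; move: dg; rewrite /offdiag val_iwM val_iwV.
  have := valP u; have := valP g; have := iw_pred_diag (valP u).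
  have := iw_pred_diag (valP g); move: Hi Hj.
  case: (val u) (val g) => [[[a1 b1] c1] d1] [[[a2 b2] c2] d2] /= Hi Hj d2' d1'.
  move=> /andP[_ /= a2'] /andP[_ /= a1'] [db dc].
  split.
    have -> : d2 * b1 + - b2 * d1 - 0 = b1 * (d2 - 1) - b2 * (d1 - 1) + (b1 - i%:R)
       - (b2 - (1 *+ (j + 2 * i) + 1 *+ (2 * (i + j)))) - 3 * (i%:R + j%:R).
      by rewrite !(natrD, natrM); ring.
    apply: dv3B; last exact: dv3_3.
    apply: dv3B => //; apply: dv3D => //; apply: dv3B; exact: dv3Ml.
  have -> : - c2 * a1 + a2 * c1 - 0 = c1 * (a2 - 1) - c2 * (a1 - 1) + (c1 - j%:R)
     - (c2 - (-1 *+ (j + 2 * i) + 1 *+ (2 * (i + j)))).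
    by rewrite mulNrn !(natrD, natrM); ring.
  apply: dv3B => //; apply: dv3D => //; apply: dv3B; exact: dv3Ml.
rewrite -[u](mulKVg g) groupM //.
(* [radg 2] lies in the derived subgroup, as [der_weight 1 = 2], and hence in the Frattini
   subgroup. *)
rewrite mem_gen // inE; apply/orP; left; rewrite (Phi_joing pS) mem_gen // inE.
by apply/orP; left; apply: (fintype.subsetP (radg_der 1)).
Qed.

(** [a] is a unit, so the determinant gives [d] from [a], [b], [c]. *)
Lemma card_iwahori : #|[set: S]| = (#|[set a : R | dv3 1 (a - 1)%R]| * #|R| * #|R|)%N.
Proof.
pose f (u : S) := (val u).1.
have f_inj : injective f.
  move=> u v; rewrite /f => e; apply: val_inj.
  have := valP u; have := valP v; move: e.
  case: (val u) (val v) => [[[a b] c] d] [[[a' b'] c'] d'] /= [<- <- <-].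
  move=> /andP[/eqP/= e1 /dv3P[s /eqP e2]] /andP[/eqP/= e3 _].
  have ua : a \is a GRing.unit.
    by rewrite -(subrK 1 a) (eqP e2) expr1 addrC unit3.
  by congr (_, _, _, _); apply: (mulrI ua); apply: (addIr (- (3 * b * c))); rewrite e1.
rewrite -(card_imset _ f_inj).
have -> : f @: [set: S] =
    finset.setX (finset.setX [set a : R | dv3 1 (a - 1)] [set: R]) [set: R].
  apply/setP=> -[[a b] c]; rewrite !inE /= !andbT; apply/imsetP/idP.
    case=> u _; rewrite /f; have := valP u.
    by case: (val u) => [[[? ?] ?] ?] /andP[_ /= da] [-> _ _].
  move=> da; have /dv3P[s /eqP e2] := da.
  have ua : a \is a GRing.unit.
    by rewrite -(subrK 1 a) (eqP e2) expr1 addrC unit3.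
  have pu : iw_pred (a, b, c, a^-1 * (1 + 3 * b * c)).
    by rewrite /iw_pred /= da andbT mulrA mulrV // mul1r addrK.
  by exists (Iwahori pu); rewrite ?inE.
by rewrite !cardsX !cardsT.
Qed.

End Generators.

(** * The coefficient ring Z/3^(n+1) *)

Lemma hensel_theta k : exists t q r : nat,
  (2 * t ^ 2 + 1 = 3 ^ k.+1 * q)%N /\ (t = 1 + 3 * r)%N.
Proof.
elim: k => [|k [t [q [r [Dq Dt]]]]]; first by exists 1%N, 1%N, 0%N.
(* Newton step: the increment adds [8 t * 3^(k+1) * q] to first order, and [1 + 8 t] is divisible by
   3 because [t = 1] modulo 3. *)
exists (t + 2 * (3 ^ k.+1 * q))%N, (q * (3 + 8 * r) + 8 * (3 ^ k * q ^ 2))%N.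
exists (r + 2 * (3 ^ k * q))%N; split; last by rewrite {1}Dt expnS; lia.
have -> : (2 * (t + 2 * (3 ^ k.+1 * q)) ^ 2 + 1 =
   2 * t ^ 2 + 1 + 8 * t * (3 ^ k.+1 * q) + 8 * (3 ^ k.+1 * q) ^ 2)%N by lia.
by rewrite Dq Dt !expnS; lia.
Qed.

Section ZmodModel.
Variable n : nat.
Let q := (3 ^ n.+1)%N.
Local Notation R := ('Z_q).
Local Open Scope ring_scope.
Import GRing.Theory.

Let q_gt1 : (1 < q)%N.
Proof. by rewrite /q expnS; have := expn_gt0 3 n; lia. Qed.

Let Zq_nat (r : R) : r = (val r)%:R.
Proof. by rewrite natr_Zp. Qed.

Let Zq_eq0 (m : nat) : (m%:R == 0 :> R) = (q %| m)%N.
Proof. by rewrite -val_eqE /= val_Zp_nat. Qed.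

Let nil3 : (3 : R) ^+ n.+1 = 0.
Proof. by apply/eqP; rewrite -natrX Zq_eq0. Qed.

Let nz3 : (3 : R) ^+ n != 0.
Proof.
rewrite -natrX Zq_eq0 gtnNdvd ?expn_gt0 // /q expnS.
by have := expn_gt0 3 n; lia.
Qed.

Let unit3 (r : R) : 1 + 3 * r \is a GRing.unit.
Proof.
rewrite [r]Zq_nat -natrM -[1]/(1%:R) -natrD unitZpE // /q coprimeXl //.
by rewrite prime_coprime // dvdn_addl ?dvdn_mulr.
Qed.

Let card_one_mod3 : #|[set a : R | dv3 1 (a - 1)]| = (3 ^ n)%N.
Proof.
pose f (i : 'I_(3 ^ n)) : R := 1 + 3 * (val i)%:R.
have f_inj : injective f.
  move=> i j /addrI; rewrite -!natrM => /(congr1 (fun z : R => val z)) /=.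
  rewrite !val_Zp_nat // !modn_small /q ?expnS ?ltn_pmul2l // => /eqP.
  by rewrite eqn_pmul2l // => /eqP/val_inj.
rewrite -[RHS]card_ord -(card_imset _ f_inj); apply: eq_card => a.
rewrite inE; apply/dv3P/imsetP => [[s /eqP]|[i _ ->]]; last first.
  by exists (val i)%:R; rewrite /f addrC addKr.
rewrite expr1 subr_eq addrC => /eqP->.
have lt_s : (val s %% 3 ^ n < 3 ^ n)%N by rewrite ltn_pmod ?expn_gt0.
exists (Ordinal lt_s); rewrite ?inE // /f /=; congr (_ + _).
rewrite {1}[s]Zq_nat -!natrM {1}(divn_eq (val s) (3 ^ n)) mulnDr natrD.
suff /eqP-> : (3 * (val s %/ 3 ^ n * 3 ^ n))%:R == 0 :> R by rewrite add0r.
by rewrite Zq_eq0 mulnCA -expnS dvdn_mull.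
Qed.

(** These properties are all that is used of the matrix group from here on. *)
Lemma iwahori_model : exists (S : finGroupType) (x y : S),
  [/\ [/\ #|[set: S]| = (3 ^ (3 * n + 2))%N, (3.-group [set: S])%g &
         <<[set x; y]>>%g = [set: S]],
      (x ^+ 3 = 1)%g,
      [/\ forall u, commute (y ^+ (3 ^ n))%g u & (y ^+ (3 ^ n) ^+ 3 = 1)%g],
      (y * x * y * x^-1 * y = y^-1 * x^-1 * y^-1 * x * y^-1)%g &
      forall k, (der_weight k < 2 * n.+1)%N -> ([set: S]^`(k) != 1)%g].
Proof.
have [t [d [r [Dt Dr]]]] := hensel_theta n.
have theta_sqr : 2 * (t%:R : R) ^+ 2 = -1.
  apply/eqP; rewrite -subr_eq0 opprK -natrX -natrM -[1]/(1%:R) -natrD Zq_eq0 Dt.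
  exact: dvdn_mulr.
have theta_1 : dv3 1 (t%:R - 1 : R).
  by apply/dv3P; exists r%:R; rewrite Dr natrD natrM addrC addKr.
have residue3 (a : R) : exists i : nat, dv3 1 (a - i%:R).
  by exists (val a); rewrite -Zq_nat subrr dv3_zero.
have cardS : #|[set: iwahori R]| = (3 ^ (3 * n + 2))%N.
  rewrite (card_iwahori unit3) card_one_mod3 card_ord Zp_cast // /q.
  by rewrite -!expnD; congr (_ ^ _)%N; lia.
have pS : (3.-group [set: iwahori R])%g by rewrite /pgroup cardS pnatX.
exists (iwahori R), (iw_x R), (iw_y theta_sqr theta_1); split.
- by split=> //; apply: (iw_gen nil3).
- exact: iw_x_cube.
- by split; [move=> u; apply: (iw_y_central nil3) | apply: (iw_y_order nil3)].
- exact: iw_rel_t.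
by move=> k; apply: (iw_der_neq1 nil3 unit3 nz3).
Qed.

End ZmodModel.

Local Open Scope card_scope.
Local Open Scope group_scope.

(** * Lower central series *)

Section LowerCentralSeries.
Variable gT : finGroupType.
Implicit Types (a b c g s : gT) (i j k m : nat).
Local Notation L k := ('L_k([set: gT])).

(** By induction on [j], with the three subgroup lemma applied modulo the target term. *)
Lemma lcn_commG i j : [~: L i.+1, L j.+1] \subset L (i + j).+2.
Proof.
elim: j i => [|j IHj] i; first by rewrite addn0 lcn1 lcnSn.
pose N := ('L_(i + j.+1).+2([set: gT]))%G; rewrite -[L (i + _).+2]/(gval N).
have nN (A : {set gT}) : A \subset 'N(N).
  by rewrite (fintype.subset_trans (finset.subsetT A)) ?lcn_norm.
have sub1 (A B C : {set gT}) :
    ([~: A, B, C] \subset N) = ([~: A / N, B / N, C / N] :==: 1).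
  by rewrite -!quotientR // -subG1 quotient_sub1.
rewrite commGC (lcnSn j) sub1; apply/eqP/three_subgroup; apply/eqP; rewrite -sub1.
  by rewrite (commGC [set: gT]) -lcnSn (fintype.subset_trans (IHj _)) //= addSnnS.
by rewrite /= addnS (lcnSn (i + j).+1) commSg.
Qed.

Lemma lcn_le i j a : a \in L i -> (j <= i)%N -> a \in L j.
Proof. by move=> La le_ji; apply: fintype.subsetP La; apply: lcn_sub_leq. Qed.

Lemma mem_lcnR i j k a b :
  a \in L i -> b \in L j -> (k <= i + j)%N -> [~ a, b] \in L k.
Proof.
move=> La Lb le_k.
have nL m c : c \in 'N(L m) by rewrite (fintype.subsetP (lcn_norm m _)) ?inE.
(* [L 0] and [L 1] are both the whole group, so for an index 0 the claim is normality of the other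
   term. *)
case: i j La Lb le_k => [|i] [|j] La Lb le_k.
- by rewrite (@lcn_le 0) // inE.
- apply: lcn_le le_k; rewrite commgEr; apply: groupM => //.
  by rewrite memJ_norm ?groupV //; apply: nL.
- rewrite addn0 in le_k; apply: lcn_le le_k.
  rewrite commgEl; apply: groupM; first by rewrite groupV.
  by rewrite memJ_norm //; apply: nL.
apply: (@lcn_le (i + j).+2); last by rewrite -addnS -addSn.
by apply: (fintype.subsetP (lcn_commG i j)); apply: mem_commg.
Qed.

(** Congruence modulo [L m] is written as equality of cosets. Every element normalises [L m], so the
    morphism rules below carry no side conditions. *)
Definition lcoset_class m : gT -> coset_of (L m) := coset (L m).
Local Notation cls := lcoset_class.

Lemma cls_norm m a : a \in 'N(L m).
Proof. by rewrite (fintype.subsetP (lcn_norm m _)) ?inE. Qed.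

Lemma cls_1 m : cls m 1 = 1.
Proof. exact: morph1. Qed.
Lemma clsM m a b : cls m (a * b) = cls m a * cls m b.
Proof. by rewrite /cls morphM ?cls_norm. Qed.
Lemma clsV m a : cls m a^-1 = (cls m a)^-1.
Proof. by rewrite /cls morphV ?cls_norm. Qed.
Lemma clsX m a i : cls m (a ^+ i) = cls m a ^+ i.
Proof. by rewrite /cls morphX ?cls_norm. Qed.
Lemma clsR m a b : cls m [~ a, b] = [~ cls m a, cls m b].
Proof. by rewrite /cls morphR ?cls_norm. Qed.

Lemma cls1P m a : reflect (cls m a = 1) (a \in L m).
Proof.
apply: (iffP idP) => [La | cls_a]; first by rewrite /cls coset_id.
by apply: coset_idr; rewrite ?cls_norm.
Qed.

Lemma clsP m a b : (cls m a = cls m b) <-> (a^-1 * b \in L m).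
Proof.
split=> [eq_ab|/cls1P]; first by apply/cls1P; rewrite clsM clsV eq_ab mulVg.
by rewrite clsM clsV => /eqP; rewrite -eq_mulVg1 => /eqP.
Qed.

Lemma cls_le m k a b : cls m a = cls m b -> (k <= m)%N -> cls k a = cls k b.
Proof. by move=> /clsP Lab le_km; apply/clsP; apply: lcn_le Lab le_km. Qed.

Lemma cls_mem m a b : cls m a = cls m b -> a \in L m -> b \in L m.
Proof. by move=> eq_ab /cls1P a1; apply/cls1P; rewrite -eq_ab. Qed.

Lemma cls_commute m i j a b :
  a \in L i -> b \in L j -> (m <= i + j)%N -> commute (cls m a) (cls m b).
Proof.
move=> La Lb le_m; apply/commgP/eqP; rewrite -clsR; apply/cls1P.
exact: mem_lcnR La Lb le_m.
Qed.

Lemma cls_mulr m a b : b \in L m -> cls m (a * b) = cls m a.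
Proof. by move=> /cls1P b1; rewrite clsM b1 mulg1. Qed.

(** With [b = a d] and [d] in [L m], [[a d, s] = [a, s]^d [d, s]], and both corrections lie one
    level deeper. *)
Lemma clsRl m a b s : cls m a = cls m b -> cls m.+1 [~ a, s] = cls m.+1 [~ b, s].
Proof.
move=> /clsP; set d := _ * b => Ld; have -> : b = a * d by rewrite mulKVg.
have Ls : s \in L 1 by rewrite inE.
rewrite commMgJ conjg_mulR [RHS]cls_mulr; last first.
  by apply: mem_lcnR Ld Ls _; rewrite addn1.
rewrite [RHS]cls_mulr //.
have Las : [~ a, s] \in L 1 by rewrite inE.
by apply: mem_lcnR Las Ld _.
Qed.

(** Modulo [L m] the commutator commutes with [a] and [b], so the class 2 power formula applies; its
    exponent 3 is the binomial coefficient C(3, 2). *)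
Lemma cls_cubeM m i j a b :
    a \in L i -> b \in L j -> (m <= 2 * i + j)%N -> (m <= i + 2 * j)%N ->
  cls m ((a * b) ^+ 3) = cls m (a ^+ 3 * b ^+ 3 * [~ b, a] ^+ 3).
Proof.
move=> La Lb le1 le2.
have Lc : [~ b, a] \in L (i + j) by apply: mem_lcnR Lb La _; rewrite addnC.
have ca : commute (cls m a) [~ cls m b, cls m a].
  by rewrite -clsR; apply: cls_commute La Lc _; lia.
have cb : commute (cls m b) [~ cls m b, cls m a].
  by rewrite -clsR; apply: cls_commute Lb Lc _; lia.
by rewrite clsX clsM (expMg_Rmul 3 cb ca) -clsR -!clsX -!clsM.
Qed.

End LowerCentralSeries.

(** * Cubing along the lower central series *)

Section Elementary.
Variable gT : finGroupType.
Implicit Types (a b c g s : gT) (i j k m : nat).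
Local Notation L k := ('L_k([set: gT])).
Local Notation cls := (@lcoset_class gT).

Hypothesis cube1 : forall g, g ^+ 3 \in L 2.

Lemma lcn_ind_comm k (P : gT -> Prop) :
    P 1 -> (forall a b, a \in L k.+1 -> b \in L k.+1 -> P a -> P b -> P (a * b)) ->
    (forall g s, g \in L k -> P [~ g, s]) -> (0 < k)%N ->
  forall a, a \in L k.+1 -> P a.
Proof.
case: k => // k P1 PM PR _ a; rewrite lcnSn => /gen_prodgP[r [c Pc ->{a}]].
have Pi (i : 'I_r) : c i \in L k.+2 /\ P (c i).
  have /imset2P[g s Lg _ ->] := Pc i; split; last exact: PR.
  by rewrite lcnSn; apply: mem_commg; rewrite ?inE.
suff [] : \prod_(i < r) c i \in L k.+2 /\ P (\prod_(i < r) c i) by [].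
elim/big_ind: _ => [|u v [Lu Pu] [Lv Pv]|i _]; last exact: Pi.
  by split=> //; apply: group1.
by split; [apply: groupM | apply: PM].
Qed.

Lemma lcn_cube1 k g : (0 < k)%N -> g \in L k -> g ^+ 3 \in L k.+1.
Proof.
case: k => // k _; elim: k g => [|k IHk] g Lg; first exact: cube1.
move: g Lg; apply: lcn_ind_comm => // [|a b La Lb La3 Lb3|g s Lg].
- by rewrite expg1n group1.
- apply/cls1P; rewrite (@cls_cubeM _ _ k.+2 k.+2) //; try lia.
  apply/cls1P; apply: groupM; first exact: groupM.
  by apply: groupX; apply: mem_lcnR Lb La _; lia.
apply/cls1P; rewrite clsX clsR -commXg -?clsX -?clsR.
  by apply/cls1P; apply: (@mem_lcnR _ k.+2 1); rewrite ?inE ?IHk //; lia.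
have Ls : s \in L 1 by rewrite inE.
have Lc : [~ g, s] \in L k.+2 by apply: mem_lcnR Lg Ls _; lia.
by apply: cls_commute Lg Lc _; lia.
Qed.

(** Expand [[g^3, s] = g^-3 (g [g, s])^3]. The correction [[g, s, g]^3] lies in [L (2 k + 2)], hence
    in [L (k + 4)] as [k >= 2]. *)
Lemma cls_cubeR k g s : (1 < k)%N -> g \in L k ->
  cls (k + 4) [~ g ^+ 3, s] = cls (k + 4) ([~ g, s] ^+ 3).
Proof.
move=> k_gt1 Lg; have Ls : s \in L 1 by rewrite inE.
have Lc : [~ g, s] \in L k.+1 by apply: mem_lcnR Lg Ls _; lia.
rewrite [[~ _ ^+ 3, _]]commgEl conjXg conjg_mulR.
rewrite (clsM _ (g ^+ 3)^-1) (@cls_cubeM _ _ k k.+1) //; try lia.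
rewrite -clsM -mulgA mulKg cls_mulr //.
have Ld : [~ g, s, g] \in L (k.+1 + k) by apply: mem_lcnR Lc Lg _.
by apply: lcn_le (lcn_cube1 _ Ld) _; lia.
Qed.

Hypothesis cube2 : forall g, g \in L 2 -> g ^+ 3 \in L 4.

Lemma lcn_cube k g : (1 < k)%N -> g \in L k -> g ^+ 3 \in L k.+2.
Proof.
case: k => // -[//|k] _; elim: k g => [|k IHk] g Lg; first exact: cube2.
move: g Lg; apply: lcn_ind_comm => // [|a b La Lb La3 Lb3|g s Lg].
- by rewrite expg1n group1.
- apply/cls1P; rewrite (@cls_cubeM _ _ k.+3 k.+3) //; try lia.
  apply/cls1P; apply: groupM; first exact: groupM.
  by apply: groupX; apply: mem_lcnR Lb La _; lia.
have /(cls_le (k := k.+2.+3)) := cls_cubeR s (isT : (1 < k.+2)%N) Lg.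
move=> /(_ ltac:(lia)) eq_c; apply: cls_mem eq_c _.
by apply: (@mem_lcnR _ k.+4 1); rewrite ?inE ?IHk //; lia.
Qed.

(** Write [b = a d]: both [d^3] and [[d, a]] lie in [L (k + 3)], the latter because
    [2 k + 1 >= k + 3]. *)
Lemma cls_cube k a b : (1 < k)%N -> a \in L k ->
  cls k.+1 a = cls k.+1 b -> cls k.+3 (a ^+ 3) = cls k.+3 (b ^+ 3).
Proof.
move=> k_gt1 La /clsP; set d := _ * b => Ld.
have -> : b = a * d by rewrite mulKVg.
rewrite (@cls_cubeM _ _ k k.+1) //; try lia.
rewrite [RHS]cls_mulr; first by rewrite [RHS]cls_mulr // lcn_cube // ltnW.
by apply: groupX; apply: mem_lcnR Ld La _; lia.
Qed.

End Elementary.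

(** Reduces group words, and so proves identities that hold in every group. *)
Ltac gsimpl := rewrite /commg /conjg ?(expgS, expg0)
  !(invg1, invgM, invgK, mulgA, mulgK, mulgKV, mulVg, mulgV, mul1g, mulg1).

Lemma odd_sqr_mem (gT : finGroupType) (H : {group gT}) (a : gT) :
  odd #[a] -> a ^+ 2 \in H -> a \in H.
Proof.
move=> odd_a Ha2; have := groupX ((#[a]).+1./2) Ha2.
by rewrite -expgM mul2n even_halfK /= ?odd_a // expgS expg_order mulg1.
Qed.

Lemma odd_sqr_inj (gT : finGroupType) (a b : gT) :
  odd #|[set: gT]| -> a ^+ 2 = b ^+ 2 -> a = b.
Proof.
move=> odd_G eq_ab.
have sqrtK (c : gT) : (c ^+ 2) ^+ (#|[set: gT]|.+1./2) = c.
  by rewrite -expgM mul2n even_halfK /= ?odd_G // expgS expg_cardG ?inE ?mulg1.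
by rewrite -[a]sqrtK -[b]sqrtK eq_ab.
Qed.

(** * Generators and orders of the lower central factors *)

Section Generation.
Variable gT : finGroupType.
Implicit Types (a b c g s : gT) (i j k m : nat).
Local Notation L k := ('L_k([set: gT])).
Local Notation cls := (@lcoset_class gT).

(** Commutation is bilinear from [L k] and [G] to [L (k + 1)] modulo [L (k + 2)], so generators
    suffice in both arguments. The bilinearity enters through [H'], the part of [H] in [L (k + 1)],
    which is normal because [H] contains [L (k + 2)]. *)
Lemma lcn_gen_step (X T : {set gT}) (H : {group gT}) k :
    (0 < k)%N -> <<X>> = [set: gT] -> L k \subset T <*> L k.+1 ->
    L k.+2 \subset H -> {in T & X, forall t s, [~ t, s] \in H} ->
    {in T, forall t, t \in L k} ->
  L k.+1 \subset H.
Proof.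
move=> k_gt0 genX genT sH HTX LT.
have [H' memH'] : exists H' : {group gT},
    forall h, h \in H' <-> h \in H /\ h \in L k.+1.
  by exists (H :&: L k.+1)%G => h; rewrite finset.in_setI; split=> /andP.
have H'J h g : h \in H' -> h ^ g \in H'.
  move=> /memH'[Hh Lh]; rewrite conjg_mulR.
  have Lr : [~ h, g] \in L k.+2.
    by apply: (@mem_lcnR _ k.+1 1); rewrite ?inE //; lia.
  apply/memH'; split; apply: groupM => //; first exact: (fintype.subsetP sH).
  by apply: lcn_le Lr _.
have LR g s : g \in L k -> [~ g, s] \in L k.+1.
  by move=> Lg; apply: (@mem_lcnR _ k 1); rewrite ?inE //; lia.
have TG t s : t \in T -> [~ t, s] \in H'.
  move=> Tt.
  have gr : group_set [set s | [~ t, s] \in H'].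
    apply/group_setP; split=> [|a b]; rewrite !inE ?commg1 ?group1 //.
    by move=> Ha Hb; rewrite commgMJ groupM ?H'J.
  have sXG : <<X>> \subset Group gr.
    rewrite gen_subG; apply/fintype.subsetP=> r Xr; rewrite inE; apply/memH'.
    by split; [apply: HTX | apply/LR/LT].
  by have := fintype.subsetP sXG s; rewrite genX !inE; apply.
have LG g s : g \in L k -> [~ g, s] \in H'.
  have gr : group_set [set g | [~ g, s] \in H'].
    apply/group_setP; split=> [|a b]; rewrite !inE ?comm1g ?group1 //.
    by move=> Ha Hb; rewrite commMgJ groupM ?H'J.
  have sTG : T <*> L k.+1 \subset Group gr.
    rewrite gen_subG finset.subUset; apply/andP; split; apply/fintype.subsetP=> t.
      by move=> Tt; rewrite inE; apply: TG.
    move=> Lt; rewrite inE; apply/memH'.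
    have Lr : [~ t, s] \in L k.+2.
      by apply: (@mem_lcnR _ k.+1 1); rewrite ?inE //; lia.
    by split; [apply: (fintype.subsetP sH) | apply: lcn_le Lr _].
  by move=> /(fintype.subsetP genT)/(fintype.subsetP sTG); rewrite inE.
case: k k_gt0 memH' {genT sH LT LR H'J TG} LG => // k _ memH' LG.
rewrite lcnSn gen_subG; apply/fintype.subsetP=> _ /imset2P[g s Lg _ ->].
by have /memH'[] := LG g s Lg.
Qed.

Lemma lcn_card1 k a : L k \subset [set a] <*> L k.+1 -> a ^+ 3 \in L k.+1 ->
  (#|L k| <= 3 * #|L k.+1|)%N.
Proof.
move=> genL La3; have nL (A : {set gT}) : A \subset 'N(L k.+1).
  by rewrite (fintype.subset_trans (finset.subsetT A)) ?lcn_norm.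
rewrite -(LagrangeI (L k)%G (L k.+1)%G) /= (finset.setIidPr (lcn_subS _ _)) mulnC.
rewrite leq_mul2r -card_quotient // orbC.
have sub : L k / L k.+1 \subset <[cls k.+1 a]>.
  apply: fintype.subset_trans (quotientS _ genL) _.
  rewrite joingE quotient_gen // gen_subG quotientU finset.subUset.
  rewrite trivg_quotient sub1G andbT quotientE morphimEsub //.
  by rewrite finset.imset_set1 finset.sub1set cycle_id.
rewrite (leq_trans (subset_leq_card sub)) // -orderE dvdn_leq //.
by rewrite order_dvdn -clsX; apply/eqP/cls1P.
Qed.

(** The factor lies in a product of two commuting cyclic groups of order at most 3. *)
Lemma lcn_card2 k a b : (0 < k)%N -> a \in L k -> b \in L k ->
    L k \subset [set a; b] <*> L k.+1 ->
    a ^+ 3 \in L k.+1 -> b ^+ 3 \in L k.+1 ->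
  (#|L k| <= 9 * #|L k.+1|)%N.
Proof.
move=> k_gt0 La Lb genL La3 Lb3; have nL (A : {set gT}) : A \subset 'N(L k.+1).
  by rewrite (fintype.subset_trans (finset.subsetT A)) ?lcn_norm.
rewrite -(LagrangeI (L k)%G (L k.+1)%G) /= (finset.setIidPr (lcn_subS _ _)) mulnC.
rewrite leq_mul2r -card_quotient // orbC.
have cab : commute (cls k.+1 a) (cls k.+1 b) by apply: cls_commute La Lb _; lia.
have sub : L k / L k.+1 \subset <[cls k.+1 a]> * <[cls k.+1 b]>.
  apply: fintype.subset_trans (quotientS _ genL) _.
  rewrite joingE quotient_gen // -cent_joinEr.
    rewrite gen_subG quotientU finset.subUset trivg_quotient sub1G andbT.
    rewrite quotientE morphimEsub // imsetU !finset.imset_set1 finset.subUset.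
    rewrite !finset.sub1set.
    by rewrite !mem_gen // inE cycle_id ?orbT.
  by rewrite /= cycle_subG /= cent_cycle; apply/cent1P/commute_sym.
have o3 c : c ^+ 3 \in L k.+1 -> (#|<[cls k.+1 c]>| <= 3)%N.
  move=> Lc; rewrite -orderE dvdn_leq // order_dvdn -clsX.
  by apply/eqP/cls1P.
rewrite (leq_trans (subset_leq_card sub)) //.
apply: leq_trans (leq_mul (o3 _ La3) (o3 _ Lb3)).
by rewrite mul_cardG leq_pmulr ?cardG_gt0.
Qed.

End Generation.

(** * Upper bounds for 3-groups satisfying the relations *)

Section UpperBound.
Variables (gT : finGroupType) (x y : gT) (n : nat).
Local Notation L k := ('L_k([set: gT])).
Local Notation cls := (@lcoset_class gT).
Hypotheses (pG : 3.-group [set: gT]) (genG : <<[set x; y]>> = [set: gT]).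
Hypotheses (n_gt0 : (0 < n)%N) (rel_x : x ^+ 3 = y ^+ (3 ^ n)).
Hypothesis rel_t : y * x * y * x^-1 * y = y^-1 * x^-1 * y^-1 * x * y^-1.

Let w := [~ y, x].
Let v := [~ w, x].
Let u := [~ v, x].

Let odd_mem (H : {group gT}) (a : gT) : a ^+ 2 \in H -> a \in H.
Proof.
apply: odd_sqr_mem; have /dvdn_odd : #[a] %| #|[set: gT]|.
  by apply: order_dvdG; rewrite inE.
by apply; apply: odd_pgroup_odd pG.
Qed.

Let L1 a : a \in L 1. Proof. by rewrite inE. Qed.

Let Lr k a s : a \in L k -> [~ a, s] \in L k.+1.
Proof. by move=> La; apply: mem_lcnR La (L1 s) _; lia. Qed.

Let Lw : w \in L 2. Proof. exact: Lr. Qed.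
Let Lv : v \in L 3. Proof. exact: Lr. Qed.
Let Lu : u \in L 4. Proof. exact: Lr. Qed.

(** The relation says that [y x y x^-1 y] times the same word with [x] inverted is 1. Conjugating
    this product by [y] and collecting gives [y^6] times commutators exactly, without any
    congruence. *)
Lemma rel_t_comm :
  let w' := w ^ x^-1 in y ^+ 3 ^+ 2 * [~ y ^+ 3, w'] * [~ w', x] = 1.
Proof.
move=> w'; pose E := y * x * y * x^-1 * y * (y * x^-1 * y * x * y).
have -> : y ^+ 3 ^+ 2 * [~ y ^+ 3, w'] * [~ w', x] = y * E * y^-1.
  by rewrite /E /w' /w; gsimpl.
suff -> : E = 1 by rewrite mulg1 mulgV.
by rewrite /E rel_t; gsimpl.
Qed.

(** The relation puts [y^6] in [L 2], and a square root can be taken in a group of odd order. *)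
Lemma cube_y_lcn2 : y ^+ 3 \in L 2.
Proof.
apply: (@odd_mem 'L_2([set: gT])%G) => /=; apply/cls1P; have := rel_t_comm => /= e.
by rewrite -(cls_1 _ 2) -e [RHS]cls_mulr; [rewrite [RHS]cls_mulr //|]; apply: Lr.
Qed.

Lemma cube_lcn2 g : g ^+ 3 \in L 2.
Proof.
have x3 : x ^+ 3 \in L 2.
  by rewrite rel_x -(subnKC n_gt0) expnS expgM groupX ?cube_y_lcn2.
have gr : group_set [set g : gT | g ^+ 3 \in L 2].
  apply/group_setP; split=> [|a b]; rewrite !inE ?expg1n ?group1 //.
  move=> a3 b3; apply/cls1P; rewrite (@cls_cubeM _ _ 1 1) //; apply/cls1P.
  by apply: groupM; [apply: groupM | apply/groupX/Lr].
have: <<[set x; y]>> \subset Group gr.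
  rewrite gen_subG finset.subUset !finset.sub1set !inE x3.
  exact: cube_y_lcn2.
by rewrite genG => /fintype.subsetP/(_ g); rewrite !inE; apply.
Qed.

Lemma gen_lcn2 : L 2 \subset [set w] <*> L 3.
Proof.
apply: (@lcn_gen_step _ [set x; y] [set x; y]) => //.
- by rewrite lcn1 -genG genS ?finset.subsetUl.
- exact: joing_subr.
have Hw : w \in [set w] <*> L 3 by rewrite mem_gen // !inE eqxx.
move=> t s; rewrite !inE => /orP[]/eqP-> /orP[]/eqP->; rewrite ?commgg ?group1 //.
by rewrite -invg_comm groupV.
Qed.

Let cls_cube_word m (c d e : gT) : commute (cls m c) (cls m d) ->
  cls m (c * (c * d) * (c * d * d * e)) = cls m (c ^+ 3 * d ^+ 3 * e).
Proof.
move=> com; rewrite !(clsM, clsX) !expgS !expg0 !mulg1 !mulgA.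
by congr (_ * _ * _ * _); rewrite -!mulgA -com.
Qed.

(** [[a, s^3]] is the product of [c], [c^s] and [c^(s^2)]; collecting is allowed because [c] and
    [[c, s]] commute modulo [L 5]. *)
Lemma cls_comm_cube a s :
  let c := [~ a, s] in
  cls 5 [~ a, s ^+ 3] = cls 5 (c ^+ 3 * [~ c, s] ^+ 3 * [~ c, s, s]).
Proof.
move=> c; have Lc : c \in L 2 by apply: Lr.
have Lcs : [~ c, s] \in L 3 by apply: Lr.
have -> : [~ a, s ^+ 3] =
    c * (c * [~ c, s]) * (c * [~ c, s] * [~ c, s] * [~ c, s, s]).
  by rewrite /c; gsimpl.
by apply: cls_cube_word; apply: cls_commute Lc Lcs _.
Qed.

(** [x^3] is a power of [y], so [[y, x^3] = 1]; expanding it gives the second claim, in which [v^3]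
    and [u] lie in [L 4]. *)
Lemma cube_w_lcn : w ^+ 3 \in L 4 /\ cls 5 (w ^+ 3 * v ^+ 3 * u) = 1.
Proof.
have e5 : cls 5 (w ^+ 3 * v ^+ 3 * u) = 1.
  rewrite -(cls_comm_cube y x) rel_x; apply/cls1P.
  have /commgP/eqP-> : commute y (y ^+ (3 ^ n)) by apply: commuteX.
  exact: group1.
split=> //; apply/cls1P.
have /(cls_le (k := 4)) : cls 5 (w ^+ 3 * v ^+ 3 * u) = cls 5 1.
  by rewrite e5; apply/esym/cls1P/group1.
have /cls1P <- : 1 \in L 4 by apply: group1.
move=> <- //; rewrite [RHS]cls_mulr // [RHS]cls_mulr //.
by apply: lcn_cube1 => //; apply: cube_lcn2.
Qed.

Lemma cube_lcn4 g : g \in L 2 -> g ^+ 3 \in L 4.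
Proof.
have gr : group_set [set g in L 2 | g ^+ 3 \in L 4].
  apply/group_setP; split=> [|a b]; rewrite !inE ?expg1n ?group1 //.
  move=> /andP[La a3] /andP[Lb b3]; rewrite groupM //=.
  apply/cls1P; rewrite (@cls_cubeM _ _ 2 2) //; apply/cls1P.
  by apply: groupM; [apply: groupM | apply/groupX/(mem_lcnR Lb La)].
have: [set w] <*> L 3 \subset Group gr.
  rewrite gen_subG finset.subUset finset.sub1set !inE Lw cube_w_lcn.1 /=.
  apply/fintype.subsetP=> a La; rewrite inE (lcn_le La) //=.
  by apply: lcn_cube1 La => //; apply: cube_lcn2.
move=> /(fintype.subset_trans gen_lcn2)/fintype.subsetP/(_ g) sub /sub.
by rewrite inE => /andP[].
Qed.

Let cube_le := lcn_cube cube_lcn2 cube_lcn4.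
Let clscube := cls_cube cube_lcn2 cube_lcn4.
Let clscubeR := cls_cubeR cube_lcn2.

Lemma cls_u : cls 5 u = cls 5 (w ^+ 3)^-1.
Proof.
have [_] := cube_w_lcn; rewrite clsM (clsM _ (w ^+ 3)).
have /cls1P-> : v ^+ 3 \in L 5 by apply: cube_le.
by rewrite mulg1 clsV => /eqP; rewrite -eq_invg_mul => /eqP->.
Qed.

Lemma cls_cube_y : cls 4 (y ^+ 3) = cls 4 v /\ y ^+ 3 \in L 3.
Proof.
have := rel_t_comm; set w' := w ^ _ => /= e.
have Lw' : w' \in L 2 by rewrite /w' conjg_mulR groupM //; apply: lcn_le (Lr _ Lw) _.
have Lyw : [~ y ^+ 3, w'] \in L 4 by apply: mem_lcnR cube_y_lcn2 Lw' _.
have eqv : cls 4 [~ w', x] = cls 4 v.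
  by apply: clsRl; rewrite /w' conjg_mulR cls_mulr //; apply: Lr.
have e4 : cls 4 (y ^+ 3) ^+ 2 * cls 4 v = 1.
  rewrite -eqv -clsX -(cls_mulr (y ^+ 3 ^+ 2) Lyw) -clsM e.
  exact/cls1P/group1.
have Ly : y ^+ 3 \in L 3.
  apply: (@odd_mem 'L_3([set: gT])%G) => /=; apply/cls1P.
  have : cls 4 (y ^+ 3 ^+ 2 * v) = cls 4 1.
    by rewrite clsM clsX e4; apply/esym/cls1P/group1.
  move=> /(cls_le (k := 3))/(_ isT); rewrite cls_mulr // => ->.
  exact/cls1P/group1.
(* Modulo [L 4] now [y^9 = 1], so [y^6 v = 1] turns into [v = y^3]. *)
split=> //; have /cls1P : y ^+ 3 ^+ 3 \in L 4 by apply: lcn_cube1 => //; apply: cube_lcn2.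
rewrite clsX => y9; apply: (mulgI (cls 4 (y ^+ 3) ^+ 2)).
by rewrite e4 -expgSr y9.
Qed.

Lemma cls_comm_cube_y_x : cls 5 [~ y ^+ 3, x] = cls 5 (w ^+ 3)^-1.
Proof. by rewrite (clsRl x cls_cube_y.1) cls_u. Qed.

(** [[w, x]] agrees modulo [L 4] with [y^3], which commutes with [y]. *)
Lemma comm_wxy : [~ w, x, y] \in L 5.
Proof.
apply/cls1P; rewrite -(clsRl y cls_cube_y.1).
have /commgP/eqP-> : commute (y ^+ 3) y by apply/commute_sym/commuteX.
exact: cls_1.
Qed.

(** [x y] and [y x] differ by [w^-1], which commutes with [w]. Expanding [[w, x y]] and [[w, y x]]
    therefore gives [[w, x, y] = [w, y, x]] modulo [L 5]. *)
Lemma comm_wyx : [~ w, y, x] \in L 5.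
Proof.
have e : cls 5 [~ w, x * y] = cls 5 [~ w, y * x].
  rewrite (commgC x y) -(invg_comm y x) -/w (commgMR w (y * x) w^-1).
  have /commgP/eqP-> : commute w w^-1 by apply: commuteV.
  rewrite mul1g cls_mulr //; apply: (@mem_lcnR _ 3 2) => //; first exact: Lr.
  by rewrite groupV.
move: e; rewrite (commgMR w x y) (commgMR w y x).
rewrite !(clsM _ ([~ w, _] * [~ w, _])); have /cls1P-> := comm_wxy.
rewrite mulg1 !(clsM _ [~ w, _]).
have -> : cls 5 [~ w, y] * cls 5 [~ w, x] = cls 5 [~ w, x] * cls 5 [~ w, y].
  by apply: (@cls_commute _ _ 3 3); rewrite ?Lr.
move/eqP; rewrite -{1}[X in X == _]mulg1 (inj_eq (mulgI _)) eq_sym.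
by move/eqP/cls1P.
Qed.

(** As [[x, y] = w^-1], expanding [[x, y^3]] gives [w^-3 [w, y, y]^-1] modulo [L 5], while
    [cls_comm_cube_y_x] gives [w^3]. *)
Lemma cls_wyy : cls 5 [~ w, y, y] = cls 5 ((w ^+ 3) ^- 2).
Proof.
have c1 : [~ x, y] = w^-1 by rewrite -invg_comm.
have := cls_comm_cube x y; rewrite /= c1 => e.
have L1y : [~ w^-1, y] \in L 3 by apply: Lr; rewrite groupV.
have Lwy : [~ w, y] \in L 3 by apply: Lr.
have eR : cls 5 [~ w^-1, y] = cls 5 [~ w, y]^-1.
  rewrite clsR !clsV clsR commVg // -clsR.
  by apply: cls_commute Lw Lwy _.
have eRR : cls 5 [~ w^-1, y, y] = cls 5 [~ w, y, y]^-1.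
  rewrite clsR eR clsV -[cls 5 y]/(cls 5 y) commVg -?clsR ?clsV //.
  by apply: cls_commute Lwy (Lr _ Lwy) _.
move: e; rewrite -(invg_comm (y ^+ 3) x) (clsV _ [~ y ^+ 3, x]).
rewrite cls_comm_cube_y_x (clsV _ (w ^+ 3)) invgK.
rewrite (clsM _ (_ ^+ 3 * _)) (clsM _ (_ ^+ 3)).
have /cls1P-> : [~ w^-1, y] ^+ 3 \in L 5 by apply: cube_le.
rewrite mulg1 eRR expgVn (clsV _ (w ^+ 3)) (clsV _ [~ w, y, y]) => e.
rewrite (clsV _ (w ^+ 3 ^+ 2)) (clsX _ (w ^+ 3)); apply: invg_inj.
by rewrite invgK expgS expg1 {2}e mulKVg.
Qed.

(** The generator of [L (2 j + 2)] modulo the next term, by [gen_lcn_even]. *)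
Let wj j := w ^+ (3 ^ j).

Let wjS j : wj j.+1 = wj j ^+ 3.
Proof. by rewrite /wj expnSr expgM. Qed.

Let Lwj j : wj j \in L (2 * j + 2).
Proof.
elim: j => [|j IHj]; first exact: Lw.
rewrite wjS; apply: lcn_le (cube_le _ IHj) _; lia.
Qed.

(** For [j = 0] the four cases are [cls_u], [comm_wxy], [comm_wyx] and [cls_wyy]; cubing, which
    commutes with commutators to leading order, carries them from [j] to [j + 1]. *)
Lemma cls_wj_comm j s s' : s \in [set x; y] -> s' \in [set x; y] ->
  exists e, cls (2 * j + 5) [~ wj j, s, s'] = cls (2 * j + 5) (wj j.+1 ^+ e).
Proof.
move=> Xs Xs'; elim: j => [|j [e IHj]].
  have inv_exp (a : gT) : exists e, a^-1 = a ^+ e.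
    by exists (#[a]).-1; rewrite invg_expg.
  rewrite /wj; move: Xs Xs'; rewrite !inE expn0 expg1 => /orP[]/eqP-> /orP[]/eqP->.
  - by have [e De] := inv_exp (w ^+ 3); exists e; rewrite -De -cls_u.
  - exists 0; rewrite expg0 cls_1; exact/cls1P/comm_wxy.
  - exists 0; rewrite expg0 cls_1; exact/cls1P/comm_wyx.
  - have [e De] := inv_exp ((w ^+ 3) ^+ 2); exists (2 * e)%N.
    by rewrite expgM -De -cls_wyy.
exists e; have Ls : [~ wj j, s] \in L (2 * j + 3).
  by apply: lcn_le (Lr _ (Lwj j)) _; lia.
have Lss : [~ wj j, s, s'] \in L (2 * j + 4).
  by apply: lcn_le (Lr _ Ls) _; lia.
have e1 := clsRl s' (clscubeR s (_ : 1 < 2 * j + 2)%N (Lwj j)).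
have e2 := clscubeR s' (_ : 1 < 2 * j + 3)%N Ls.
have e3 := clscube (_ : 1 < 2 * j + 4)%N Lss (cls_le IHj (_ : (2 * j + 4).+1 <= _)%N).
rewrite wjS [in RHS]wjS -[wj j.+1 ^+ 3 ^+ e]expgM (mulnC 3 e) expgM.
rewrite (_ : 2 * j.+1 + 5 = (2 * j + 4).+3)%N; last by lia.
rewrite -e3; [| lia | lia].
rewrite (_ : (2 * j + 4).+3 = 2 * j + 3 + 4)%N; last by lia.
rewrite -e2; last by lia.
rewrite (_ : 2 * j + 3 + 4 = (2 * j + 2 + 4).+1)%N; last by lia.
by rewrite e1 //; lia.
Qed.

Let gen_odd_of_even j :
    L (2 * j + 2) \subset [set wj j] <*> L (2 * j + 3) ->
  L (2 * j + 3) \subset [set [~ wj j, x]; [~ wj j, y]] <*> L (2 * j + 4).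
Proof.
move=> gen_even.
rewrite addnS; apply: (@lcn_gen_step _ [set x; y] [set wj j]) => //.
- by rewrite addn_gt0 orbT.
- by rewrite -addnS.
- by rewrite -!addnS joing_subr.
- move=> t s; rewrite inE => /eqP->; rewrite !inE => /orP[]/eqP->.
    by rewrite mem_gen // !inE eqxx.
  by rewrite mem_gen // !inE eqxx orbT.
by move=> t; rewrite inE => /eqP->.
Qed.

Lemma gen_lcn_even j : L (2 * j + 2) \subset [set wj j] <*> L (2 * j + 3).
Proof.
elim: j => [|j IHj]; first exact: gen_lcn2.
have gen_odd := gen_odd_of_even IHj.
rewrite (_ : 2 * j.+1 + 2 = (2 * j + 3).+1)%N; last by lia.
apply: (@lcn_gen_step _ [set x; y] [set [~ wj j, x]; [~ wj j, y]]) => //.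
- by rewrite addn_gt0 orbT.
- by rewrite -addnS.
- by rewrite (_ : 2 * j.+1 + 3 = (2 * j + 3).+2)%N ?joing_subr //; lia.
- move=> t s' Xt Xs'.
  have [s Xs ->] : exists2 s, s \in [set x; y] & t = [~ wj j, s].
    by move: Xt; rewrite !inE => /orP[]/eqP->; [exists x | exists y] => //;
       rewrite !inE eqxx ?orbT.
  have [e /clsP Le] := cls_wj_comm j Xs Xs'.
  set a := [~ wj j, s, s'] in Le *; set b := _ ^+ e in Le.
  have -> : a = b * (a^-1 * b)^-1 by rewrite invgM invgK mulKVg.
  apply: groupM; first by rewrite groupX // mem_gen // !inE eqxx.
  rewrite groupV mem_gen // inE; apply/orP; right.
  by apply: lcn_le Le _; lia.
by move=> t; rewrite !inE => /orP[]/eqP->; apply: lcn_le (Lr _ (Lwj j)) _; lia.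
Qed.

Lemma cls_comm_y_pow j :
  y ^+ (3 ^ j.+1) \in L (2 * j + 3) /\
  cls (2 * j + 5) [~ y ^+ (3 ^ j.+1), x] = cls (2 * j + 5) (wj j.+1)^-1.
Proof.
elim: j => [|j [Ly IHj]].
  by split; [exact: cls_cube_y.2 | exact: cls_comm_cube_y_x].
have Lx : [~ y ^+ (3 ^ j.+1), x] \in L (2 * j + 4).
  by apply: lcn_le (Lr _ Ly) _; lia.
rewrite expnSr expgM wjS; split; first by apply: lcn_le (cube_le _ Ly) _; lia.
have e1 := clscubeR x (_ : 1 < 2 * j + 3)%N Ly.
have e2 := clscube (_ : 1 < 2 * j + 4)%N Lx (cls_le IHj (_ : (2 * j + 4).+1 <= _)%N).
rewrite -expgVn (_ : 2 * j.+1 + 5 = (2 * j + 4).+3)%N; last by lia.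
rewrite -e2; [| lia | lia].
rewrite (_ : (2 * j + 4).+3 = 2 * j + 3 + 4)%N; last by lia.
by rewrite e1 //; lia.
Qed.

(** [y^(3^n) = x^3] commutes with [x], so by [cls_comm_y_pow] the generator [wj n] of [L (2 n + 2)]
    falls into [L (2 n + 3)]. The two terms agree, and nilpotency makes them trivial. *)
Lemma lcn_trivial : L (2 * n + 2) = 1.
Proof.
have nilG := pgroup_nil pG.
(* Nilpotency is used through its definition: a subgroup [H] contained in [[H, G]] is trivial. *)
have /forall_inP/(_ ('L_(2 * n + 2)([set: gT]))%G) := nilG.
rewrite finset.subsetI finset.subsetT addn2 -lcnSn.
move=> triv; apply/eqP/triv; rewrite /=.
have [_ e] := cls_comm_y_pow n.-1; rewrite prednK // in e.
have Ln : wj n \in L (2 * n + 3).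
  apply/cls1P; apply: invg_inj; rewrite invg1 -clsV.
  rewrite (_ : 2 * n + 3 = 2 * n.-1 + 5)%N; last by lia.
  rewrite -e -rel_x.
  have /commgP/eqP-> : commute (x ^+ 3) x by apply/commute_sym/commuteX.
  exact: cls_1.
have := gen_lcn_even n; rewrite !addnS addn0 => /fintype.subset_trans; apply.
rewrite gen_subG finset.subUset finset.sub1set; apply/andP; split=> //.
by rewrite addnS addn2 in Ln.
Qed.

(** Each odd factor has order at most 9 and each even factor at most 3, so a pair contributes at
    most 27. *)
Lemma card_lcn_odd m : (#|[set: gT]| <= 3 ^ (3 * m) * #|L (2 * m + 1)|)%N.
Proof.
elim: m => [|m IHm]; first by rewrite mul1n.
apply: leq_trans IHm _.
have c3 := lcn_cube1 cube_lcn2.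
have le_odd : (#|L (2 * m + 1)| <= 9 * #|L (2 * m + 2)|)%N.
  case: m => [|m].
    apply: (@lcn_card2 _ 1 x y) => //; try exact: cube_lcn2.
    by rewrite lcn1 -genG genS ?finset.subsetUl.
  rewrite (_ : 2 * m.+1 + 1 = 2 * m + 3)%N; last by lia.
  rewrite (_ : 2 * m.+1 + 2 = (2 * m + 3).+1)%N; last by lia.
  have Ls s : [~ wj m, s] \in L (2 * m + 3).
    by apply: lcn_le (Lr _ (Lwj m)) _; lia.
  apply: (@lcn_card2 _ _ [~ wj m, x] [~ wj m, y]) => //; try lia.
  - by rewrite -addnS; apply/gen_odd_of_even/gen_lcn_even.
  - by apply: c3 => //; lia.
  - by apply: c3 => //; lia.
have le_even : (#|L (2 * m + 2)| <= 3 * #|L (2 * m + 3)|)%N.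
  rewrite (_ : 2 * m + 3 = (2 * m + 2).+1)%N; last by lia.
  apply: (@lcn_card1 _ _ (wj m)); first by rewrite -addnS; apply: gen_lcn_even.
  by apply: c3 (Lwj m); lia.
rewrite (_ : 2 * m.+1 + 1 = 2 * m + 3)%N; last by lia.
rewrite (_ : 3 ^ (3 * m.+1) = 3 ^ (3 * m) * 27)%N; last first.
  by rewrite mulnS addnC expnD.
by rewrite -mulnA leq_mul2l; apply/orP; right; lia.
Qed.

Lemma card_lcn_last : (#|[set: gT]| <= 3 ^ (3 * n + 2))%N.
Proof.
apply: leq_trans (card_lcn_odd n) _; rewrite expnD leq_mul2l; apply/orP; right.
have Ls s : [~ wj n.-1, s] \in L (2 * n + 1).
  by apply: lcn_le (Lr _ (Lwj _)) _; lia.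
have c3 := lcn_cube1 cube_lcn2.
have := @lcn_card2 _ (2 * n + 1) [~ wj n.-1, x] [~ wj n.-1, y].
rewrite -addnS lcn_trivial cards1; apply=> //; try lia.
- rewrite -lcn_trivial (_ : 2 * n + 1 = 2 * n.-1 + 3)%N; last by lia.
  rewrite (_ : 2 * n + 2 = 2 * n.-1 + 4)%N; last by lia.
  exact/gen_odd_of_even/gen_lcn_even.
- by rewrite -lcn_trivial addnS; apply: c3 => //; lia.
- by rewrite -lcn_trivial addnS; apply: c3 => //; lia.
Qed.

(* L_{2j} is cyclic modulo L_{2j+1}, hence the extra 1. *)
Lemma comm_lcn_even j : [~: L (2 * j + 2), L (2 * j + 2)] \subset L (4 * j + 5).
Proof.
pose N := ('L_(4 * j + 5)([set: gT]))%G; rewrite -[L (4 * j + 5)]/(gval N).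
have nN (A : {set gT}) : A \subset 'N(N).
  by rewrite (fintype.subset_trans (finset.subsetT A)) ?lcn_norm.
rewrite -quotient_cents2 //.
have comG i (A B : {set gT}) k : A \subset L i -> B \subset L k ->
    (4 * j + 5 <= i + k)%N -> A / N \subset 'C(B / N).
  move=> sA sB le_ik; apply: quotient_cents2r; rewrite gen_subG.
  apply/fintype.subsetP=> _ /imset2P[a b Aa Bb ->].
  apply: mem_lcnR le_ik; first exact: (fintype.subsetP sA).
  exact: (fintype.subsetP sB).
have sw : [set wj j] \subset L (2 * j + 2) by rewrite finset.sub1set.
have gen : L (2 * j + 2) / N \subset <<([set wj j] / N) :|: (L (2 * j + 3) / N)>>.
  by rewrite -quotientU -quotient_gen ?quotientS // gen_lcn_even.
apply: fintype.subset_trans gen _; rewrite gen_subG finset.subUset; apply/andP; split.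
  rewrite centsC; apply: fintype.subset_trans (quotientS _ (gen_lcn_even j)) _.
  rewrite joingE quotient_gen // gen_subG quotientU finset.subUset; apply/andP; split.
    by apply: quotient_cents; rewrite cent_set1 finset.sub1set; apply/cent1P.
  by apply: (comG (2 * j + 3) _ _ (2 * j + 2)) => //; lia.
by apply: (comG (2 * j + 3) _ _ (2 * j + 2)); rewrite //; lia.
Qed.

End UpperBound.

(** * The finite model *)

(** Makes a two-generator subgroup a type of its own, so that results stated for [[set: gT]] apply
    to it. *)
Lemma gen2_type (gT : finGroupType) (x y : gT) :
  exists (rT : finGroupType) (f : {morphism [set: rT] >-> gT}) (x' y' : rT),
    [/\ 'injm f, f @* [set: rT] = <<[set x; y]>>, f x' = x, f y' = y &
        <<[set x'; y']>> = [set: rT]].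
Proof.
pose Q := <<[set x; y]>>%G.
have Qx : x \in Q by rewrite mem_gen // !inE eqxx.
have Qy : y \in Q by rewrite mem_gen // !inE eqxx orbT.
exists (subg_of Q), (sgval_morphism Q), (subg Q x), (subg Q y).
have inj : 'injm (sgval_morphism Q) by apply/injmP=> u v _ _; apply: subg_inj.
have im : sgval_morphism Q @* [set: subg_of Q] = Q by apply: im_sgval.
split=> //; [exact: subgK | exact: subgK |].
apply/eqP; rewrite finset.eqEsubset finset.subsetT /= -(injmSK inj) //.
rewrite morphim_gen ?finset.subsetT // im gen_subG.
rewrite finset.subUset !finset.sub1set; apply/andP.
split; apply: mem_gen; rewrite morphimEsub ?finset.subsetT //.
  by apply/imsetP; exists (subg Q x); rewrite ?inE ?eqxx //= subgK.
by apply/imsetP; exists (subg Q y); rewrite ?inE ?eqxx ?orbT //= subgK.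
Qed.

(** * Twisting by Z/9 to repair the first relation *)

Section Twist.
Variables (S : finGroupType) (x y : S) (n : nat).
Hypotheses (pS : 3.-group [set: S]) (genS : <<[set x; y]>> = [set: S]).
Hypothesis x3 : x ^+ 3 = 1.
Hypothesis y_central : forall u, commute (y ^+ (3 ^ n)) u.
Hypothesis y_order : y ^+ (3 ^ n) ^+ 3 = 1.
Hypothesis rel_t : y * x * y * x^-1 * y = y^-1 * x^-1 * y^-1 * x * y^-1.

(** The law of ['I_9] is addition: [1] is the residue 0 and [z] the residue 1. *)
Let z : 'I_9 := Zp1.
Let T := (S * 'I_9)%type.
Let X : T := (x, z).
Let Y : T := (y, 1).
Let E := <<[set X; Y]>>%G.
(** This is [X^3 Y^-(3^n)], a central element with trivial cube; the first relation holds in the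
    quotient by it. *)
Let c : T := ((y ^+ (3 ^ n))^-1, z ^+ 3).
Let C := <[c]>%G.

Let zC (u v : 'I_9) : commute u v.
Proof. by apply: val_inj; rewrite /= addnC. Qed.

Let pairX (u : T) k : u ^+ k = (u.1 ^+ k, u.2 ^+ k).
Proof. by elim: k => [|k IHk]; rewrite ?expg0 // !expgS IHk. Qed.

Let z9 : z ^+ 3 ^+ 3 = 1.
Proof. by rewrite -expgM -(expg_order z) /z order_Zp1. Qed.

Let z3 : #[z ^+ 3] = 3.
Proof. by rewrite orderXdiv /z order_Zp1. Qed.

Let cC (u : T) : commute c u.
Proof. by congr pair; [apply/commute_sym/commuteV/commute_sym/y_central | apply: zC]. Qed.

Let nC (A : {set T}) : A \subset 'N(C).
Proof.
apply: cents_norm; rewrite centsC cycle_subG; apply/centP=> u _; exact: cC.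
Qed.

Let EX : X \in E. Proof. by rewrite mem_gen // !inE eqxx. Qed.
Let EY : Y \in E. Proof. by rewrite mem_gen // !inE eqxx orbT. Qed.

Let Ez : (1, z ^+ 3) \in E.
Proof. by have := groupX 3 EX; rewrite pairX /= x3. Qed.

Let Ec : c \in E.
Proof.
have -> : c = (Y ^+ (3 ^ n))^-1 * (1, z ^+ 3).
  by rewrite pairX /= expg1n; congr pair; rewrite /= ?mulg1 ?invg1 ?mul1g.
by rewrite groupM // groupV groupX.
Qed.

Let c3 : c ^+ 3 = 1.
Proof. by rewrite pairX /= expgVn y_order invg1 z9. Qed.

Let fstE : fst @* E = [set: S].
Proof.
rewrite morphim_gen ?finset.subsetT // -genS; congr <<_>>.
by rewrite morphimEsub ?finset.subsetT // imsetU !finset.imset_set1.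
Qed.

(** The projection of [E] to [S] is onto with [(1, z^3)], of order 3, in its kernel. This factor 3
    pays for the quotient by [C]. *)
Let cardE : (3 * #|[set: S]| <= #|E|)%N.
Proof.
rewrite -[[set: S]]fstE card_morphim finset.setTI.
rewrite -[X in (_ <= X)%N](LagrangeI E ('ker (@fst S 'I_9))) leq_mul2r; apply/orP; right.
have o3 : #[z ^+ 3] %| #[(1, z ^+ 3) : T].
  rewrite order_dvdn.
  by have /eqP := expg_order ((1, z ^+ 3) : T); rewrite pairX => /eqP[_ /eqP].
rewrite z3 in o3; apply: leq_trans (dvdn_leq (order_gt0 _) o3) _.
rewrite orderE subset_leq_card // cycle_subG; apply/setIP; split=> //.
by apply/kerP; rewrite ?inE.
Qed.

Let derE k u : (0 < k)%N -> u \in E^`(k) -> u.2 = 1.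
Proof.
case: k => // k _ Eu; have Eu1 : u \in E^`(1).
  apply: (fintype.subsetP (dergS 1 (der_sub k E))).
  by rewrite -[(E^`(k))^`(1)]/(E^`(k.+1)).
have : E^`(1) \subset 'ker (@snd S 'I_9).
  rewrite gen_subG; apply/fintype.subsetP=> _ /imset2P[a b _ _ ->].
  apply/kerP; rewrite ?inE // morphR ?inE //=.
  by apply/eqP/commgP; apply: zC.
by move=> /fintype.subsetP/(_ u Eu1)/kerP; apply; rewrite inE.
Qed.

(** Proper derived groups of [E] have trivial second coordinate, and the only such element of [C] is
    1, so they survive in [E / C]. *)
Let derE_triv k : (0 < k)%N -> E^`(k) / C = 1 -> [set: S]^`(k) = 1.
Proof.
move=> k_gt0; rewrite -fstE -morphim_der ?finset.subsetT // => triv.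
suff -> : E^`(k) = 1 by rewrite morphim1.
apply/trivgP/fintype.subsetP=> u Eu.
have : E^`(k) \subset C by rewrite -quotient_sub1 // triv.
move=> /fintype.subsetP/(_ u Eu)/cycleP[i Du].
have e := derE k_gt0 Eu; rewrite Du pairX /= in e; move/eqP: e.
rewrite -order_dvdn z3 => /dvdnP[j Di].
by rewrite Du Di mulnC expgM c3 expg1n set11.
Qed.

Lemma twist_model : exists (gT : finGroupType) (a b : gT),
  [/\ [/\ 3.-group [set: gT], <<[set a; b]>> = [set: gT] &
         (#|[set: S]| <= #|[set: gT]|)%N],
      a ^+ 3 = b ^+ (3 ^ n),
      b * a * b * a^-1 * b = b^-1 * a^-1 * b^-1 * a * b^-1 &
      forall k, (0 < k)%N -> [set: S]^`(k) != 1 -> [set: gT]^`(k) != 1].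
Proof.
have [gT [f [a [b [inj imf fa fb gen]]]]] := gen2_type (coset C X) (coset C Y).
have nCu u : u \in 'N(C) by rewrite (fintype.subsetP (nC [set u])) ?inE.
have imE : f @* [set: gT] = E / C.
  rewrite imf quotient_gen //; congr <<_>>.
  by rewrite quotientE morphimEsub // imsetU !finset.imset_set1.
have fI : injective f by move=> u v; apply: (injmP inj); rewrite inE.
have fM u v : f (u * v) = f u * f v by rewrite morphM ?inE.
have fV u : f u^-1 = (f u)^-1 by rewrite morphV ?inE.
have fX u k : f (u ^+ k) = f u ^+ k by rewrite morphX ?inE.
exists gT, a, b; split.
- split=> //.
    rewrite /pgroup -(card_injm inj) // imE -/(pgroup _ _) quotient_pgroup //.
    apply: (pgroupS (finset.subsetT _)).
    rewrite /pgroup cardsT card_prod card_ord pnatM -cardsT; apply/andP.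
    by split; [exact: pS |].
  rewrite -(card_injm inj) // imE card_quotient // -(leq_pmul2l (isT : 0 < 3)%N).
  apply: leq_trans cardE _; rewrite -(Lagrange (_ : C \subset E)) ?cycle_subG //.
  rewrite leq_mul2r; apply/orP; right; rewrite -orderE dvdn_leq // order_dvdn.
  by rewrite c3.
- apply: fI; rewrite !fX fa fb -!morphX //.
  apply/eqP; rewrite eq_mulgV1 -morphV // -morphM //; apply/eqP/coset_id.
  have -> : X ^+ 3 * (Y ^+ (3 ^ n))^-1 = c.
    by rewrite !pairX /= x3 expg1n; congr pair; rewrite /= ?mul1g ?invg1 ?mulg1.
  exact: cycle_id.
- apply: fI; rewrite !fM !fV fa fb -!morphV // -!morphM //.
  congr coset; congr pair; first exact: rel_t.
  by rewrite /= !invg1 !mul1g !mulg1 mulgV mulVg.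
move=> k k_gt0; apply: contra_neq => triv; apply: derE_triv k_gt0 _.
by rewrite quotient_der // -imE -morphim_der ?finset.subsetT // triv morphim1.
Qed.

End Twist.

(* For 3-groups, where squaring is injective, the first relator amounts to
   [x ^+ 3 = y ^+ (3 ^ n)]. *)
Definition rel_pair (gT : groupType) n (x y : gT) : Prop :=
  x ^+ 3 = y ^+ (3 ^ n) /\
  y * x * y * x^-1 * y = y^-1 * x^-1 * y^-1 * x * y^-1.

(** For odd weight this is the general commutator bound; for even weight [comm_lcn_even] gains one
    more. *)
Lemma der_sub_lcn (gT : finGroupType) (x y : gT) n k :
    3.-group [set: gT] -> <<[set x; y]>> = [set: gT] -> (0 < n)%N ->
    rel_pair n x y ->
  [set: gT]^`(k) \subset 'L_(der_weight k)([set: gT]).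
Proof.
move=> pG genG n_gt0 [rel_x rel_t]; elim: k => [//|k IHk].
rewrite dergSn; apply: fintype.subset_trans (commgSS IHk IHk) _ => /=.
have := der_weight_gt0 k; case: ifP; set m := der_weight k => odd_m m_gt0.
  case: m odd_m m_gt0 => // m _ _.
  by rewrite (_ : m.+1.*2 = (m + m).+2) ?lcn_commG //; lia.
have [j ->] : exists j, m = (2 * j + 2)%N.
  by exists (m./2.-1); have := odd_double_half m; rewrite odd_m; lia.
have := comm_lcn_even pG genG n_gt0 rel_x rel_t j.
by rewrite (_ : (2 * j + 2).*2.+1 = 4 * j + 5)%N //; lia.
Qed.

(** The twisted group has at least, and by [card_lcn_last] at most, [3^(3 n + 2)] elements; class
    and derived length are squeezed likewise. *)
Lemma finite_model n : (0 < n)%N -> exists (gT : finGroupType) (x y : gT),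
  [/\ [/\ 3.-group [set: gT], <<[set x; y]>> = [set: gT] & rel_pair n x y],
      #|[set: gT]| = (3 ^ (3 * n + 2))%N,
      nil_class [set: gT] = (2 * n + 1)%N &
      has_derived_length [set: gT] (trunc_log 2 (3 * n + 3))].
Proof.
move=> n_gt0.
have [S [x [y [[cardS pS genS] x3 [y_central y_order] relS derS]]]] := iwahori_model n.
have [gT [a [b [[pG genG leG] rel_x rel_t derG]]]] :=
  twist_model pS genS x3 y_central y_order relS.
have cardG : #|[set: gT]| = (3 ^ (3 * n + 2))%N.
  apply/eqP; rewrite eqn_leq -{2}cardS leG andbT.
  exact: (card_lcn_last pG genG n_gt0 rel_x rel_t).
have L_triv := lcn_trivial pG genG n_gt0 rel_x rel_t.
exists gT, a, b; split=> //.
  have nilG := pgroup_nil pG.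
  apply/eqP; rewrite eqn_leq; apply/andP; split.
    by apply/(lcn_nil_classP _ nilG); rewrite -addnS.
  (* Were [L (2 n + 1)] trivial, the order would be at most [3^(3 n)]. *)
  rewrite addn1 ltnNge; apply/negP=> /(lcn_nil_classP _ nilG) L1.
  have := card_lcn_odd pG genG n_gt0 rel_x rel_t n.
  rewrite addn1 L1 cards1 muln1 cardG leq_exp2l //; lia.
have /andP[log_le log_lt] : (2 ^ trunc_log 2 (3 * n + 3) <= 3 * n + 3 <
    2 ^ (trunc_log 2 (3 * n + 3)).+1)%N by apply: trunc_log_bounds; lia.
set d := trunc_log _ _ in log_le log_lt *; split.
  (* [2^(d+1) > 3 n + 3] makes the weight at least [2 n + 2]. *)
  apply/trivgP; apply: fintype.subset_trans (der_sub_lcn d pG genG n_gt0 _) _ => //.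
  rewrite -L_triv lcn_sub_leq //.
  have [_] := der_weightE d; move: log_lt; rewrite !expnS.
  by case: (odd d); lia.
(* Index 0 is settled by the order, since [twist_model] compares derived groups of positive index
   only. *)
case=> [|k] lt_kd; apply/eqP.
  rewrite derg0 -cardG_gt1 /= cardG.
  by apply: (@leq_trans (3 ^ 1)); rewrite // leq_exp2l //; lia.
apply: derG => //; apply: derS.
have [_] := der_weightE k.+1.
have : (2 ^ k.+2 <= 2 ^ d)%N by rewrite leq_exp2l.
by rewrite [(2 ^ k.+3)%N]expnS; case: (odd _); lia.
Qed.

(** The subgroup of [rT * gT] generated by [(a, x)] and [(b, y)] satisfies the relations, so its
    order is at most that of [gT]. As it projects onto [gT], the projection is bijective and the
    subgroup is the graph of the homomorphism sought. *)
Lemma von_dyck n (gT rT : finGroupType) (x y : gT) (a b : rT) : (0 < n)%N ->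
    3.-group [set: gT] -> <<[set x; y]>> = [set: gT] ->
    #|[set: gT]| = (3 ^ (3 * n + 2))%N -> rel_pair n x y ->
    3.-group [set: rT] -> rel_pair n a b ->
  exists f : gT -> rT, [/\ {morph f : u v / u * v}, f x = a & f y = b].
Proof.
move=> n_gt0 pG genG cardG [rel_x rel_t] pR [rel_a rel_b].
pose T := (rT * gT)%type.
have [Q [f [x' [y' [inj imf fx fy genQ]]]]] := gen2_type ((a, x) : T) ((b, y) : T).
have fI : injective f by move=> u v; apply: (injmP inj); rewrite inE.
have fM u v : f (u * v) = f u * f v by rewrite morphM ?inE.
have fV u : f u^-1 = (f u)^-1 by rewrite morphV ?inE.
have fX u k : f (u ^+ k) = f u ^+ k by rewrite morphX ?inE.
have pairX (u : T) k : u ^+ k = (u.1 ^+ k, u.2 ^+ k).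
  by elim: k => [|k IHk]; rewrite ?expg0 // !expgS IHk.
have leQ : (#|[set: Q]| <= #|[set: gT]|)%N.
  rewrite cardG; apply: (@card_lcn_last Q x' y') => //.
  - rewrite /pgroup -(card_injm inj) // -/(pgroup _ _).
    apply: (pgroupS (finset.subsetT _)).
    by rewrite /pgroup cardsT card_prod pnatM -!cardsT; apply/andP.
  - by apply: fI; rewrite !fX fx fy !pairX /= rel_a rel_x.
  - by apply: fI; rewrite !fM !fV fx fy; congr pair.
have surj h : exists u, (f u).2 == h.
  have : h \in snd @* (f @* [set: Q]).
    rewrite imf morphim_gen ?finset.subsetT // morphimEsub ?finset.subsetT //.
    by rewrite imsetU !finset.imset_set1 genG inE.
  by case/morphimP=> _ _ /morphimP[u _ _ ->] ->; exists u.
pose s h := xchoose (surj h).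
have sK h : (f (s h)).2 = h by apply/eqP/(xchooseP (surj h)).
have s_inj : injective s by move=> h k e; rewrite -[h]sK -[k]sK e.
have [t tK Ks] : bijective s by apply: inj_card_bij; rewrite // -!cardsT.
have gI u v : (f u).2 = (f v).2 -> u = v.
  by move=> e; rewrite -[u]Ks -[v]Ks -[t u]sK -[t v]sK !Ks e.
have sM h k : s (h * k) = s h * s k by apply: gI; rewrite fM /= !sK.
have sx : s x = x' by apply: gI; rewrite sK fx.
have sy : s y = y' by apply: gI; rewrite sK fy.
exists (fun h => (f (s h)).1); split=> [h k||]; first by rewrite sM fM.
  by rewrite sx fx.
by rewrite sy fy.
Qed.

(** * Pro-3 groups *)

(** An alias that carries the discrete topology without imposing it on every finite group type. *)
Definition discrete_group (gT : finGroupType) : Type := gT.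

Section DiscreteGroup.
Variable gT : finGroupType.
HB.instance Definition _ := monoid.Group.copy (discrete_group gT) gT.
HB.instance Definition _ := hasNbhs.Build (discrete_group gT) principal_filter.
HB.instance Definition _ := Discrete_ofNbhs.Build (discrete_group gT) erefl.

Lemma discrete_mulg_continuous :
  continuous (fun z : discrete_group gT * discrete_group gT => z.1 * z.2).
Proof.
move=> [u v] A /nbhs_singleton /= Auv.
exists ([set u], [set v])%classic; first by split; apply: discrete_set1.
by move=> [u' v'] /= [-> ->].
Qed.

Lemma discrete_continuous (T : topologicalType) (f : discrete_group gT -> T) :
  continuous f.
Proof.
move=> u A /nbhs_singleton Afu; rewrite nbhs_simpl /=.
apply: (@filterS _ (nbhs u) _ [set u]%classic); first by move=> _ ->.
exact: discrete_set1.
Qed.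

HB.instance Definition _ := isTopGroup.Build (discrete_group gT)
  discrete_mulg_continuous (@discrete_continuous _ _).

Lemma discrete_profinite : profinite (discrete_group gT).
Proof.
split; first exact/finite_compact/(@finite_finset gT).
  exact: discrete_hausdorff.
move=> B /nbhs_singleton B1; exists [set 1]%classic; split.
- exact: discrete_open.
- split=> [//|u v -> ->|u ->]; first by rewrite /= mulg1.
  by rewrite /= invg1.
- by move=> _ ->.
Qed.

Lemma left_cosets_card (U : {group gT}) :
  left_cosets ([set u | u \in U]%classic : set gT) #= `I_#|[set: gT] : U|.
Proof.
rewrite -card_lcosets; pose L := lcosets U [set: gT].
pose f i : set gT := [set u | u \in nth finset.set0 (enum L) i]%classic.
have L_lt i : (i < #|L|)%N -> (i < size (enum L))%N by rewrite -cardE.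
have -> : left_cosets ([set u | u \in U]%classic : set gT) = (f @` `I_#|L|)%classic.
  apply/seteqP; split=> [_ [g _ <-]|_ [i /= lt_i <-]].
    have Lg : g *: U \in L by apply/lcosetsP; exists g; rewrite ?inE.
    exists (index (g *: U) (enum L)).
      by rewrite /= cardE index_mem mem_enum.
    rewrite /f nth_index ?mem_enum //; apply/seteqP; split=> u /=.
      by case/lcosetP=> v Uv ->; exists v.
    by case=> v Uv <-; apply/lcosetP; exists v.
  have : nth finset.set0 (enum L) i \in L by rewrite -mem_enum mem_nth // L_lt.
  case/lcosetsP=> g _ Dg; exists g => //; rewrite /f Dg.
  apply/seteqP; split=> u /=.
    by case=> v Uv <-; apply/lcosetP; exists v.
  by case/lcosetP=> v Uv ->; exists v.
apply: inj_card_eq => i j; rewrite !inE /= => lt_i lt_j eq_f.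
apply/eqP; rewrite -(nth_uniq finset.set0 (L_lt _ lt_i) (L_lt _ lt_j) (enum_uniq _)).
apply/eqP/setP=> u; have /seteqP[sij sji] := eq_f.
by apply/idP/idP; [apply: sij | apply: sji].
Qed.

Lemma discrete_pro_p p : prime p -> p.-group [set: gT] -> pro_p p (discrete_group gT).
Proof.
move=> p_pr pG; split; first exact: discrete_profinite.
move=> U _ [[U1 UM UV] _].
have gr : group_set [set u : gT | `[< U u >]].
  apply/group_setP; split=> [|u v]; rewrite !inE; first exact: U1.
  exact: UM.
have -> : U = ([set u | u \in Group gr]%classic : set gT).
  apply/seteqP; split=> u; rewrite /= inE /=; first exact: asboolT.
  exact: asboolW.
have [k Dk] := p_natP (pnat_dvd (dvdn_indexg [set: gT]%G (Group gr)) pG).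
by exists k; rewrite -Dk; apply: left_cosets_card.
Qed.

End DiscreteGroup.

(** * Open normal subgroups of profinite groups *)

Section TopGroup.
Variable G : topGroupType.
Implicit Types (A N U V W : set G) (g u v : G).

Lemma mulgl_continuous g : continuous (fun u : G => g * u).
Proof.
move=> u; have c : {for u, continuous (fun v : G => (g, v))}.
  by apply: cvg_pair; [apply: cst_continuous | apply: cvg_id].
exact: continuous_comp c (mulg_continuous (g, u)).
Qed.

Lemma conjg_continuous : continuous (fun z : G * G => z.1 ^ z.2).
Proof.
move=> [u g].
have c1 : {for (u, g), continuous (fun z : G * G => (z.2^-1, z.1 * z.2))}.
  apply: cvg_pair; last exact: (mulg_continuous (u, g)).
  have c2 : {for (u, g), continuous (@snd G G)} by apply: cvg_snd.
  exact: (continuous_comp c2 (invg_continuous g)).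
exact: (continuous_comp c1 (mulg_continuous (g^-1, u * g))).
Qed.

Lemma subgroup_open U : is_subgroup U -> nbhs (1 : G) U -> open U.
Proof.
move=> [U1 UM UV] nU; rewrite openE => u Uu.
have : nbhs (u^-1 * u) U by rewrite mulVg.
move=> /(mulgl_continuous (g := u^-1)) ; rewrite /interior nbhs_simpl /=.
apply: filterS => v /= Uv; rewrite -[v](mulKVg u); exact: UM.
Qed.

Lemma open_normal_core U : compact [set: G]%classic -> open U -> is_subgroup U ->
  exists W : set G, [/\ open W, is_normal_subgroup W & (W `<=` U)%classic].
Proof.
move=> cG oU sU; have [U1 UM UV] := sU.
pose W : set G := [set u | forall g, U (u ^ g)]%classic.
have sW : is_subgroup W.
  split=> [g|u v Wu Wv g|u Wu g]; first by rewrite conj1g.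
    by rewrite conjMg; apply: UM.
  by rewrite conjVg; apply: UV.
exists W; split.
- apply: subgroup_open => //.
  (* The intersection of all conjugates is open: [u ^ g] lies in [U] for [u] near 1, locally in [g],
     and compactness makes this uniform in [g]. *)
  have /compact_near_coveringP/(_ G (nbhs (1 : G)) (fun u g => U (u ^ g)) _) := cG.
  move=> near_cov.
  have : \forall u \near (1 : G), ([set: G] `<=` (fun g => U (u ^ g)))%classic.
    apply: near_cov => g _.
    have nU : nbhs ((1 : G) ^ g) U by rewrite conj1g; apply: open_nbhs_nbhs.
    have [[A B] /= [nA nB] sAB] := conjg_continuous (x := (1, g)) nU.
    exists (B, A) => //= -[g' u] /= [Bg' Au]; exact: (sAB (u, g')).
  by apply: filterS => u Uu g; apply: Uu.
- split=> // u g Wu h; rewrite -conjgM; exact: Wu.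
by move=> u /(_ 1); rewrite conjg1.
Qed.

(** The complement of [N] contains [g W] for some open normal [W], and [V = N W] serves. *)
Lemma closed_normal_separation N g : profinite G -> closed N ->
    is_normal_subgroup N -> ~ N g ->
  exists V : set G, [/\ open V, is_normal_subgroup V, (N `<=` V)%classic & ~ V g].
Proof.
move=> [cG _ smallG] cN [[N1 NM NV] NJ] Ng.
have nB : nbhs (1 : G) [set u | ~ N (g * u)]%classic.
  have nNg : nbhs (g * 1) (~` N)%classic.
    by rewrite mulg1; apply: open_nbhs_nbhs; split=> //; apply: closed_openC.
  exact: mulgl_continuous nNg.
have [U [oU sU UB]] := smallG _ nB.
have [W [oW [[W1 WM WV] WJ] WU]] := open_normal_core cG oU sU.
pose V : set G := [set v | exists2 a, N a & W (a^-1 * v)]%classic.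
have sV : is_subgroup V.
  split.
  - by exists 1; rewrite // mulg1 invg1.
  - move=> u v [a Na Wa] [b Nb Wb].
    exists (a * (b ^ (a^-1 * u)^-1)); first by apply: NM => //; apply: NJ.
    have -> : (a * b ^ (a^-1 * u)^-1)^-1 * (u * v) = (a^-1 * u) * (b^-1 * v).
      by rewrite /conjg !(invgM, invgK, mulgA, mulgK, mulgKV, mulVg, mulgV, mul1g).
    exact: WM.
  - move=> u [a Na Wa]; exists (a^-1 ^ u); first by apply/NJ/NV.
    have -> : (a^-1 ^ u)^-1 * u^-1 = (a^-1 * u)^-1.
      by rewrite /conjg !(invgM, invgK, mulgA, mulgK).
    exact: WV.
have WV' : (W `<=` V)%classic by move=> w Ww; exists 1; rewrite // invg1 mul1g.
exists V; split.
- apply: subgroup_open => //; apply: filterS WV' _.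
  by apply: open_nbhs_nbhs.
- split=> // u h [a Na Wa]; exists (a ^ h); first exact: NJ.
  by rewrite -conjVg -conjMg; apply: WJ.
- by move=> a Na; exists a; rewrite // mulVg.
case=> a Na Wa.
have := UB _ (WU _ (WV _ Wa)); apply => /=.
by rewrite invgM invgK mulKVg.
Qed.

End TopGroup.

Lemma left_coset_index (G : groupType) (V : set G) m :
    is_subgroup V -> left_cosets V #= `I_m ->
  exists c : G -> 'I_m,
    (forall u v, c u = c v <-> V (u^-1 * v)) /\ (forall i, exists u, c u = i).
Proof.
move=> [V1 VM VV] /card_bijP[phi [psi phiK psiK]].
pose cs u : left_cosets V := SigSub (mem_set
  (imageP (fun g => [set g * v | v in V]%classic) (I : [set: G]%classic u))).
have lt_c u : (val (phi (cs u)) < m)%N by have /set_mem := valP (phi (cs u)).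
exists (fun u => Ordinal (lt_c u)); split=> [u v|i].
  split=> [eq_c|Vuv].
    have eq_cs : cs u = cs v.
      apply: (can_inj phiK); apply: val_inj.
      exact: (congr1 (fun i : 'I_m => val i) eq_c).
    have /= e := congr1 (fun A : left_cosets V => val A) eq_cs.
    have : [set u * a | a in V]%classic v by rewrite e; exists 1; rewrite ?mulg1.
    by case=> a Va <-; rewrite mulKg.
  apply: val_inj => /=; congr (val (phi _)); apply: val_inj => /=.
  apply/seteqP; split=> _ [a Va <-].
    exists ((u^-1 * v)^-1 * a); first by apply: VM => //; apply: VV.
    by rewrite invgM invgK !mulgA mulgV mul1g.
  exists (u^-1 * v * a); first exact: VM.
  by rewrite !mulgA mulgV mul1g.
have lt_i : (i : nat) \in (`I_m)%classic by rewrite inE /= ltn_ord.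
have /set_mem[u _ Du] := valP (psi (SigSub lt_i)).
exists u; apply: val_inj => /=.
have -> : cs u = psi (SigSub lt_i) by apply: val_inj.
by rewrite psiK.
Qed.

(** The group law is carried to ['I_m] through a section [s] of the coset map, which makes the
    quotient a [finGroupType]; the map is continuous because it is constant on cosets of the open
    [V]. *)
Lemma finite_quotient (G : topGroupType) (V : set G) m :
    open V -> is_normal_subgroup V -> left_cosets V #= `I_m ->
  exists (gT : finGroupType) (f : G -> discrete_group gT),
    [/\ topgroup_hom f, forall u, f u = 1 <-> V u & #|[set: gT]| = m].
Proof.
move=> oV nV cV; have [[V1 VM VV] VJ] := nV.
have [c [cP c_surj]] := left_coset_index (proj1 nV) cV.
have [s sK] := choice c_surj.
have cM u v u' v' : c u = c u' -> c v = c v' -> c (u * v) = c (u' * v').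
  move=> /cP Vu /cP Vv; apply/cP; rewrite invgM.
  have -> : v^-1 * u^-1 * (u' * v') = (v^-1 * v') * (u^-1 * u') ^ v'.
    by rewrite /conjg !(mulgA, mulgK, mulgKV).
  by apply: VM => //; apply: VJ.
pose mul i j := c (s i * s j).
pose one := c 1.
pose inv i := c (s i)^-1.
have mulA : associative mul.
  move=> i j k; transitivity (c (s i * s j * s k)).
    by rewrite -mulgA; apply: cM; rewrite ?sK.
  by apply: cM; rewrite ?sK.
have mul1 : left_id one mul.
  by move=> i; rewrite -[RHS]sK -[in RHS](mul1g (s i)); apply: cM; rewrite sK.
have mulV : left_inverse one inv mul.
  by move=> i; rewrite /one -(mulVg (s i)); apply: cM; rewrite sK.
pose gT : finGroupType :=
  HB.pack_for finGroupType 'I_m (Finite_isGroup.Build 'I_m mulA mul1 mulV).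
exists gT, c; split.
- split; first by move=> u v; apply: cM; rewrite sK.
  move=> u A /nbhs_singleton Au; rewrite nbhs_simpl /=.
  have : nbhs (u^-1 * u) V by rewrite mulVg; apply: open_nbhs_nbhs.
  move=> /(mulgl_continuous (g := u^-1)); rewrite nbhs_simpl /=.
  apply: filterS => v /= Vv.
  by have <- : c u = c v by apply/cP.
- move=> u; split=> [/esym/cP|Vu]; first by rewrite invg1 mul1g.
  by apply/esym/cP; rewrite invg1 mul1g.
by rewrite cardsT card_ord.
Qed.

(** * From the free pro-3 group to its finite quotients *)

Section Hom.
Variables (G H : groupType) (f : G -> H).
Hypothesis fM : {morph f : u v / u * v}.

Lemma hom1 : f 1 = 1.
Proof. by apply: (mulgI (f 1)); rewrite -fM !mulg1. Qed.
Lemma homV u : f u^-1 = (f u)^-1.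
Proof. by apply: (mulgI (f u)); rewrite -fM !mulgV hom1. Qed.
Lemma homX u k : f (u ^+ k) = f u ^+ k.
Proof. by elim: k => [|k IHk]; rewrite ?expg0 ?hom1 // !expgS fM IHk. Qed.
Lemma hom_ker_normal : is_normal_subgroup [set u | f u = 1]%classic.
Proof.
split=> [|u g /= fu]; last by rewrite /conjg !fM homV fu mul1g mulVg.
split=> [|u v /= fu fv|u /= fu]; rewrite /= ?hom1 ?fM ?homV ?fu ?fv //.
  by rewrite mulg1.
by rewrite invg1.
Qed.
End Hom.

Lemma relators_rel_pair (F : topGroupType) (x y : F) (sigma : F -> F) n
    (gT : finGroupType) (f : F -> gT) :
    {morph sigma : u v / u * v} -> sigma x = x^-1 -> sigma y = y^-1 ->
    {morph f : u v / u * v} -> 3.-group [set: gT] ->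
  (relators x y sigma n `<=` [set u | f u = 1])%classic <->
  rel_pair n (f x) (f y).
Proof.
move=> sM sx sy fM pG.
pose a := f x; pose b := f y.
have fr : f ((rword x y n)^-1 * sigma (rword x y n)) =
    (a ^+ 3 * (b ^+ (3 ^ n))^-1)^-1 * ((a ^+ 3)^-1 * b ^+ (3 ^ n)).
  rewrite /rword sM (homV sM) !(homX sM) sx sy !expgVn invgK.
  by rewrite !(fM, homV fM, homX fM).
have ft : f ((tword x y)^-1 * sigma (tword x y)) =
    (b * a * b * a^-1 * b)^-1 * (b^-1 * a^-1 * b^-1 * a * b^-1).
  rewrite /tword !sM (homV sM) sx sy invgK.
  by rewrite !(fM, homV fM).
split=> [sub|[rel_x rel_t] u].
  have /= er := sub _ (or_introl erefl); have /= et := sub _ (or_intror erefl).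
  rewrite fr in er; rewrite ft in et; split; last first.
    by apply/eqP; rewrite eq_mulVg1; apply/eqP.
  (* The relator only yields [a^6 = b^(2 * 3^n)]; the order is odd, so the squares can be
     removed. *)
  apply: odd_sqr_inj; first exact: odd_pgroup_odd pG.
  have e : a ^+ 3 * (b ^+ (3 ^ n))^-1 = (a ^+ 3)^-1 * b ^+ (3 ^ n).
    by apply/eqP; rewrite eq_mulVg1; apply/eqP.
  apply: (mulgI (a ^+ 3)^-1); apply: (mulIg (b ^+ (3 ^ n))^-1).
  by rewrite !expgS !expg0 !mulg1 mulKg e mulgA mulgK.
case=> -> /=; first by rewrite fr /a /b rel_x mulgV invg1 mul1g mulVg.
by rewrite ft /a /b rel_t mulVg.
Qed.

Theorem theorem1 (F : topGroupType) (x y : F) (sigma : F -> F)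
    (hF : free_pro_p2 3 x y)
    (hsigma : topgroup_aut sigma)
    (hx : sigma x = x^-1) (hy : sigma y = y^-1)
    (n : nat) (hn : (1 <= n)%N) :
  exists (gT : finGroupType)
         (f : presented_group (relators x y sigma n) -> gT),
    [/\ bijective f, {morph f : u v / u * v},
        [/\ 3.-group [set: gT] & #|[set: gT]| = (3 ^ (3 * n + 2))%N],
        [/\ nilpotent [set: gT] & nil_class [set: gT] = (2 * n + 1)%N] &
        has_derived_length [set: gT] (trunc_log 2 (3 * n + 3))].
Proof.
have [[sM _] _] := hsigma; have [proF univ] := hF; have [profF p_indexF] := proF.
have [gT [a [b [[pG genG rel_ab] cardG classG derG]]]] := finite_model hn.
have [f [[[fM f_cont] fx fy] _]] :=
  univ (discrete_group gT) (discrete_pro_p (isT : prime 3) pG) a b.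
pose N := closed_normal_gen (relators x y sigma n).
have nN : is_normal_subgroup N := closed_normal_genP _.
have sN : (relators x y sigma n `<=` N)%classic.
  by move=> u Ru A [_ _ RA]; apply: RA.
have cN : closed N by apply: closed_bigI => A [].
have kerN u : N u <-> f u = 1.
  split=> [Nu|fu].
    apply: (Nu [set u | f u = 1]%classic); split.
    - apply: (@preimage_closed _ _ f [set 1]%classic) => [v _|]; first exact: f_cont.
      exact: discrete_closed.
    - exact: hom_ker_normal.
    apply/(@relators_rel_pair F x y sigma n gT f sM hx hy fM pG).
    by rewrite fx fy; exact: rel_ab.
  (* If [u] were outside [N], some finite 3-quotient [g] of [F] killing [N] would not kill [u]; but
     by [von_dyck] it factors through [f]. *)
  apply: contrapT => Nu.
  have [V [oV nV NV Vu]] := closed_normal_separation profF cN nN Nu.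
  have [k cV] := p_indexF V oV nV.
  have [rT [g [[gM g_cont] kerg cardR]]] := finite_quotient oV nV cV.
  have pR : 3.-group [set: rT] by rewrite /pgroup cardR pnatX.
  have rel_g : rel_pair n (g x : rT) (g y : rT).
    apply/(@relators_rel_pair F x y sigma n rT g sM hx hy gM pR) => v Rv /=.
    exact: (proj2 (kerg v) (NV _ (sN _ Rv))).
  have [h [hM ha hb]] := von_dyck hn pG genG cardG rel_ab pR rel_g.
  (* [g] and the composite of [h] with [f] agree on [x] and [y], so uniqueness in the universal
     property identifies them. *)
  have [g0 [_ g0_uniq]] :=
    univ (discrete_group rT) (discrete_pro_p (isT : prime 3) pR) (g x) (g y).
  have eg : g0 = g by apply: g0_uniq.
  have ehf : g0 = (fun v => h (f v)).
    apply: g0_uniq; split; [split|by rewrite fx|by rewrite fy].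
      by move=> v w; rewrite fM; apply: hM.
    by move=> v; apply: continuous_comp (f_cont v) _; apply: discrete_continuous.
  by apply/Vu/kerg; rewrite -eg ehf fu; apply: (hom1 hM).
have f_surj c : exists u, f u = c.
  have gr : group_set [set c : gT | `[< exists u, f u = c >]].
    apply/group_setP; split=> [|c1 c2]; rewrite !inE; first by exists 1; apply: hom1.
    by move=> [u <-] [v <-]; exists (u * v); apply: fM.
  have : <<[set a; b]>> \subset Group gr.
    rewrite gen_subG finset.subUset !finset.sub1set !inE /=.
    by apply/andP; split; apply: asboolT; [exists x | exists y].
  by rewrite genG => /fintype.subsetP/(_ c); rewrite !inE => /(_ isT).
(* As [f] is onto with kernel [N], it induces the isomorphism on the quotient; a section of [f]
   supplies the inverse. *)
have [s sK] := choice f_surj.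
pose NS := NormalSubgroup (closed_normal_genP (relators x y sigma n)).
pose Q := presented_group (relators x y sigma n).
pose rep (q : Q) : F := generic_quotient.repr q.
pose cls (u : F) : Q := \pi_Q%qT u.
have f_eq u v : N (u^-1 * v) <-> f u = f v.
  split=> [/kerN|e]; last by apply/kerN; rewrite fM (homV fM) e mulVg.
  by rewrite fM (homV fM) => /eqP; rewrite -eq_mulVg1 => /eqP.
have f_rep u : f (rep (cls u)) = f u.
  by apply/esym/f_eq; exact: (quot_repr NS u).
have rep_cls (q : Q) : cls (rep q) = q by apply: reprK.
exists gT, (fun q : Q => f (rep q)); split=> //.
- exists (fun c => cls (s c)) => [q|c]; last by rewrite f_rep sK.
  rewrite -[RHS]rep_cls; apply/(quot_eqP NS)/f_eq.
  exact: sK.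
- move=> q1 q2; rewrite -[q1 * q2]/(cls (rep q1 * rep q2)) f_rep; exact: fM.
- by split=> //; apply: pgroup_nil pG.
Qed.
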